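(* Let $G = \Gamma *_T \Lambda$ be any amalgamated free product with $T$ a finite group, $\Lambda$ any countable group, and $\Gamma$ a group in the class $\mathit{Erg}$. Then $G$ belongs to the class $\mathit{Erg}$.
   Context: An action $\alpha$ of a discrete group $\Gamma$ on a factor $M$ is outer if $\alpha_g$ is not inner for every $g \neq e$, and ergodic if its fixed point algebra is $\mathbb{C}1$. A $1$-cocycle for $\alpha$ is a map $v : \Gamma \to \mathcal{U}(M)$ (the unitary group of $M$) with $v_{gh} = v_g\,\alpha_g(v_h)$ for all $g,h \in \Gamma$; the corresponding cocycle perturbation of $\alpha$ is the action $\operatorname{Ad} v \circ \alpha$ given by $(\operatorname{Ad} v \circ \alpha)_g = (\operatorname{Ad} v_g)\circ\alpha_g$. The class $\mathit{Erg}$ consists of all countable groups $\Gamma$ with the property that every outer action of $\Gamma$ on a II$_1$ factor with separable predual admits a cocycle perturbation that is ergodic. *)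

(* Defs.v *)
From HB Require Import structures.
From mathcomp Require Import all_boot all_order all_algebra all_fingroup.
From mathcomp Require Import sesquilinear complex.
From mathcomp Require Import boolp classical_sets functions cardinality reals.
From mathcomp Require Import topology normedtype sequences.

Set Implicit Arguments.
Unset Strict Implicit.
Unset Printing Implicit Defensive.

Import Order.TTheory GRing.Theory Num.Theory Num.Def.
Import numFieldNormedType.Exports.

Local Open Scope classical_set_scope.
Local Open Scope ring_scope.

(* The constant makes R[i] inherit the topology that MathComp-Analysis attaches
   to every abstract numClosedFieldType. *)
Definition cplx (R : realType) : numClosedFieldType := R[i]%C.

(* The inner product is linear in its first argument. *)
HB.mixin Record isHilbert (R : realType) (H : Type)
    of CompleteNormedModule (cplx R) H := {
  inner : {dot H for (@conjC (cplx R))} ;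
  inner_norm : forall u : H, inner u u = `|u| ^+ 2
}.

#[short(type="hilbertType")]
HB.structure Definition Hilbert (R : realType) :=
  { H of isHilbert R H & CompleteNormedModule (cplx R) H }.

Section Operators.
Context (R : realType) (H : hilbertType R).
Local Notation C := (cplx R).
Local Notation "'[ u , v ]" := (inner u v) : ring_scope.
(* Operators are plain functions; von Neumann algebras are sets of bounded ones,
   with product \o, unit idfun and pointwise linear structure. *)
Local Notation op := (H -> H).
Implicit Types (x y u : op) (M : set op).

Definition bounded_op : set op := [set x | linear x /\ continuous x].

(* For bounded x the adjoint exists by Riesz representation and is unique; the
   default value idfun is only reached for operators without adjoint. *)
Definition adj x : op :=
  xget (idfun : op) [set y | forall u v : H, '[x u, v] = '[u, y v]].

Definition commutant (S : set op) : set op :=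
  [set x | bounded_op x /\ forall y, S y -> x \o y = y \o x].

(* The bicommutant condition forces M to be a unital subalgebra of bounded
   operators. *)
Definition von_neumann_algebra M :=
  (forall x, M x -> M (adj x)) /\ commutant (commutant M) = M.

Definition scalars : set op := [set x | exists c : C, x = c *: (idfun : op)].

Definition factor M := von_neumann_algebra M /\ M `&` commutant M = scalars.

Definition infinite_dimensional M :=
  ~ exists n (e : 'I_n -> op),
      forall x, M x -> exists c : 'I_n -> C, x = \sum_(i < n) c i *: e i.

Definition square_summable (xi : nat -> H) :=
  cvgn (series (fun n => `|xi n| ^+ 2 : C)).

(* The predual: the sigma-weakly continuous functionals on M. Only the values of
   f on M are meaningful. *)
Definition predual M : set (op -> C) :=
  [set f | exists xi eta : nat -> H,
     [/\ square_summable xi, square_summable eta &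
         forall x, M x ->
           series (fun n => '[x (xi n), eta n]) @ \oo --> f x]].

(* Density of a sequence for the functional norm, the supremum over the unit
   ball { x in M, |x| <= 1 } of the operator norm. *)
Definition separable_predual M :=
  exists2 d : nat -> op -> C, (forall n, predual M (d n)) &
    forall f, predual M f -> forall eps : C, 0 < eps ->
      exists n, forall x, M x -> (forall xi : H, `|x xi| <= `|xi|) ->
        `|f x - d n x| <= eps.

Definition faithful_normal_tracial_state M (tau : op -> C) :=
  [/\ predual M tau,
      tau idfun = 1,
      forall x, M x -> 0 <= tau (adj x \o x),
      forall x, M x -> tau (adj x \o x) = 0 -> x = 0 &
      forall x y, M x -> M y -> tau (x \o y) = tau (y \o x)].

Definition II1_factor M :=
  [/\ factor M, infinite_dimensional M &
      exists tau, faithful_normal_tracial_state M tau].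

Definition unitary_in M u :=
  [/\ M u, adj u \o u = idfun & u \o adj u = idfun].

(* Transformations of M are functions on all operators of which only the
   restriction to M matters. *)
Definition star_automorphism M (theta : op -> op) :=
  [/\ set_bij M M theta,
      forall (c : C) x y, M x -> M y ->
        theta (c *: x + y) = c *: theta x + theta y,
      forall x y, M x -> M y -> theta (x \o y) = theta x \o theta y &
      forall x, M x -> theta (adj x) = adj (theta x)].

Definition Ad u : op -> op := fun x => u \o x \o adj u.

Definition inner_automorphism M (theta : op -> op) :=
  exists2 u, unitary_in M u & forall x, M x -> theta x = Ad u x.

Section Actions.
Context (G : groupType).
Implicit Types (alpha : G -> op -> op) (v : G -> op).

Definition is_action M alpha :=
  (forall g, star_automorphism M (alpha g)) /\
  (forall g h x, M x -> alpha (g * h)%g x = alpha g (alpha h x)).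

Definition outer_action M alpha :=
  is_action M alpha /\ forall g, g <> 1%g -> ~ inner_automorphism M (alpha g).

Definition fixed_points M alpha : set op :=
  [set x | M x /\ forall g, alpha g x = x].

Definition ergodic M alpha := fixed_points M alpha = scalars.

Definition cocycle M alpha v :=
  (forall g, unitary_in M (v g)) /\
  (forall g h, v (g * h)%g = v g \o alpha g (v h)).

Definition perturbation alpha v : G -> op -> op :=
  fun g => Ad (v g) \o alpha g.

End Actions.
End Operators.

Definition Erg (R : realType) (G : groupType) :=
  countable [set: G] /\
  forall (H : hilbertType R) (M : set (H -> H)) (alpha : G -> (H -> H) -> H -> H),
    II1_factor M -> separable_predual M -> outer_action M alpha ->
    exists2 v, cocycle M alpha v & ergodic M (perturbation alpha v).

(* G, with jA and jB, is the amalgamated free product A *_T B over the embeddings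
   iA and iB of T: the pushout in the category of groups. *)
Definition amalgamated_free_product (T A B G : groupType)
    (iA : {multiplicative T -> A}) (iB : {multiplicative T -> B})
    (jA : {multiplicative A -> G}) (jB : {multiplicative B -> G}) :=
  [/\ injective iA, injective iB, jA \o iA =1 jB \o iB &
      forall (K : groupType)
          (fA : {multiplicative A -> K}) (fB : {multiplicative B -> K}),
        fA \o iA =1 fB \o iB ->
        exists k : {multiplicative G -> K},
          [/\ k \o jA =1 fA, k \o jB =1 fB &
              forall k' : {multiplicative G -> K},
                k' \o jA =1 fA -> k' \o jB =1 fB -> k' =1 k]].

(* Main.v *)
(* A cocycle of [Gamma] with ergodic perturbation restricts to a cocycle [v] of
   the finite group [T]. Since [T] acts outerly on a II_1 factor [M], [v] is a
   coboundary, [v t = u * alpha t (star u)], and the formula on the right makes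
   sense on all of [Lambda]; the two cocycles glue over the amalgam, and fixed
   points of the glued perturbation are fixed by [Gamma], hence scalar.

   To find the unitary [u], call [z] twisted fixed when [v t * alpha t z = z]
   for all [t]. An exhaustion argument with the trace gives a twisted fixed
   partial isometry [u] whose initial space is maximal. If [p = 1 - star u * u]
   and [q = 1 - u * star u] were both nonzero, the independence of the outer
   automorphisms [alpha t] would give [x] with
   [\sum_t q * v t * alpha t x * p <> 0], a twisted fixed element whose polar
   part properly extends [u]. So [u] is isometric or coisometric, and unitary
   by the trace. *)

Require Import Defs.
From HB Require Import structures.
From mathcomp Require Import all_boot all_order all_algebra all_fingroup.
From mathcomp Require Import sesquilinear complex ring lra.
From mathcomp Require Import boolp classical_sets functions cardinality reals.
From mathcomp Require Import topology normedtype sequences.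

Set Implicit Arguments.
Unset Strict Implicit.
Unset Printing Implicit Defensive.

Import Order.TTheory GRing.Theory Num.Theory Num.Def.
Import numFieldNormedType.Exports.

Local Open Scope classical_set_scope.
Local Open Scope ring_scope.

(** * The real Hilbert space underlying a complex one *)

Section RealHilbert.
Context (R : realType) (H : hilbertType R).
Local Notation C := (cplx R).
Implicit Types (u v w : H) (a b : R) (s : nat -> H).

(** Automorphisms are only assumed to be algebraic, so nothing lets [alpha t] pass through a strong
    limit. Square roots therefore come from an iteration with an operator norm rate, which every
    automorphism respects, and a partial isometry obtained as a strong limit is accompanied by an
    algebraic statement about what annihilates it. The independence of the [alpha t] is geometric:
    the families [t |-> alpha t x (p u)] are total in a sum of copies of [H], because the projection
    onto their orthogonal complement has matrix entries that intertwine the automorphisms. The trace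
    enters through real values, so that countably many greedy choices replace Zorn's lemma. On the
    group side [G] is given by a universal property only, and each fact about it comes from a
    morphism into a group built for the purpose. Permutation groups yield the injectivity of
    [jGamma], without which the restricted actions might fail to be outer, and generation by the two
    factors, hence countability. The semidirect product with the unitary group glues the
    cocycles. *)

Definition cR a : C := (a%:C)%C.
(** Real parts suffice: [innerE] recovers the complex inner product, and estimates become
    inequalities in the ordered field [R]. *)
Definition rip u v : R := complex.Re (inner u v : R[i]).
Definition nr u : R := complex.Re (`|u| : R[i]).

Lemma cR_ReE (z : C) : 0 <= z -> z = cR (complex.Re z).
Proof. by case: z => x y; rewrite /cR lecE /= => /andP[/eqP-> _]. Qed.

Lemma le_cR a b : (cR a <= cR b) = (a <= b).
Proof. by rewrite /cR lecR. Qed.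

Lemma lt_cR a b : (cR a < cR b) = (a < b).
Proof. by rewrite /cR ltcR. Qed.

Lemma normE u : `|u| = cR (nr u) :> C.
Proof. exact/cR_ReE/normr_ge0. Qed.

Lemma nr_ge0 u : 0 <= nr u.
Proof. by rewrite -le_cR -normE (_ : cR 0 = 0) // normr_ge0. Qed.

Lemma nrD u v : nr (u + v) <= nr u + nr v.
Proof.
rewrite -le_cR -normE; apply: le_trans (ler_normD u v) _.
by rewrite !normE /cR -rmorphD.
Qed.

Lemma nrN u : nr (- u) = nr u.
Proof. by rewrite /nr normrN. Qed.

Lemma nr0 : nr (0 : H) = 0.
Proof. by rewrite /nr normr0. Qed.

Lemma nr_eq0 u : nr u = 0 -> u = 0.
Proof. by move=> e; apply/eqP; rewrite -normr_eq0 normE e. Qed.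

Lemma nrB u v : nr (u - v) <= nr u + nr v.
Proof. by rewrite -(nrN v) nrD. Qed.

Lemma nrC u v : nr (u - v) = nr (v - u).
Proof. by rewrite -nrN opprB. Qed.

Lemma nrZ a u : nr (cR a *: u) = `|a| * nr u.
Proof.
apply: (@complexI R); rewrite rmorphM /= -[LHS]normE normrZ normE.
by congr (_ * _); rewrite /cR normc_def /= expr0n addr0 sqrtr_sqr.
Qed.

Lemma ripDl u v w : rip (u + v) w = rip u w + rip v w.
Proof. by rewrite /rip linearDl raddfD. Qed.

Lemma ripC u v : rip u v = rip v u.
Proof.
by rewrite /rip (hermC (@inner R H)) /= mul1r; case: (inner v u).
Qed.

Lemma ripDr u v w : rip w (u + v) = rip w u + rip w v.
Proof. by rewrite ![rip w _]ripC ripDl. Qed.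

Lemma ripZl a u v : rip (cR a *: u) v = a * rip u v.
Proof.
rewrite /rip linearZl_LR /=; case: (inner u v) => x y /=.
by rewrite /cR /= mul0r subr0.
Qed.

Lemma ripZr a u v : rip u (cR a *: v) = a * rip u v.
Proof. by rewrite ripC ripZl ripC. Qed.

Lemma ripNl u v : rip (- u) v = - rip u v.
Proof. by rewrite /rip linearNl raddfN. Qed.

Lemma ripNr u v : rip u (- v) = - rip u v.
Proof. by rewrite ripC ripNl ripC. Qed.

Lemma rip0l v : rip 0 v = 0.
Proof. by have := ripDl 0 0 v; rewrite addr0 => e; lra. Qed.

Lemma rip0r v : rip v 0 = 0.
Proof. by rewrite ripC rip0l. Qed.

Lemma ripE u : rip u u = nr u ^+ 2.
Proof.
rewrite /rip inner_norm normE /cR -rmorphXn; done.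
Qed.

Lemma rip_inj u v : (forall w, rip w u = rip w v) -> u = v.
Proof.
move=> e; apply/eqP; rewrite -subr_eq0; apply/eqP/nr_eq0/eqP.
by rewrite -sqrf_eq0 -ripE ripDr ripNr e subrr.
Qed.

Lemma nrD2 u v : nr (u + v) ^+ 2 = nr u ^+ 2 + 2 * rip u v + nr v ^+ 2.
Proof. by rewrite -!ripE ripDl !ripDr (ripC v u); ring. Qed.

Lemma nrB2 u v : nr (u - v) ^+ 2 = nr u ^+ 2 - 2 * rip u v + nr v ^+ 2.
Proof. by rewrite nrD2 nrN ripNr; ring. Qed.

Lemma rip_le u v : rip u v <= nr u * nr v.
Proof.
have : nr (u + v) ^+ 2 <= (nr u + nr v) ^+ 2.
  by rewrite ler_sqr ?nnegrE ?addr_ge0 ?nr_ge0 ?nrD.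
by rewrite nrD2; lra.
Qed.

Lemma rip_abs u v : `|rip u v| <= nr u * nr v.
Proof.
by rewrite ler_norml rip_le andbT lerNl -ripNl -(nrN u) rip_le.
Qed.

Lemma innerE u v : inner u v = (rip u v +i* rip u ('i *: v))%C.
Proof.
rewrite /rip; have -> : inner u ('i *: v) = 'i^* * inner u v.
  by rewrite linearZr_LR.
rewrite conjCi; case: (inner u v) => x y.
have -> : 'i = ('i)%C :> C by [].
by congr (_ +i* _)%C; rewrite /=; ring.
Qed.

(** Stated as a real limit so that squeezing in [R] applies; [conv_cvg] and [cvg_conv] tie it to the
    topology of [H]. *)
Definition conv s u := (fun n => nr (s n - u)) @ \oo --> (0 : R).

Lemma conv_cvg s u : conv s u -> s @ \oo --> u.
Proof.
move=> su; apply/cvgrPdist_lt => e e0.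
have eE := cR_ReE (ltW e0); have e0' : 0 < complex.Re e by rewrite -lt_cR -eE.
move/cvgrPdist_lt: su => /(_ _ e0'); apply: filterS => n.
rewrite sub0r normrN ger0_norm ?nr_ge0 // => h.
by rewrite distrC normE eE lt_cR.
Qed.

Lemma cvg_conv s u : s @ \oo --> u -> conv s u.
Proof.
move=> su; apply/cvgrPdist_lt => e e0.
have e0' : 0 < cR e by rewrite lt_cR.
move/cvgrPdist_lt: su => /(_ _ e0'); apply: filterS => n.
rewrite sub0r normrN ger0_norm ?nr_ge0 // => h.
by rewrite -lt_cR -normE distrC.
Qed.

Lemma conv_complete s :
  (forall e : R, 0 < e ->
     exists N, forall m n, (N <= m)%N -> (N <= n)%N -> nr (s m - s n) < e) ->
  exists u, conv s u.
Proof.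
move=> cs; suff /cvg_ex[u su] : cvgn s by exists u; exact: cvg_conv.
apply/cauchy_cvgP/cauchy_ballP => e e0.
have eE := cR_ReE (ltW e0); have e0' : 0 < complex.Re e by rewrite -lt_cR -eE.
have [N hN] := cs _ e0'.
pose A := s @` [set n | (N <= n)%N].
exists (A, A) => /=.
  by split; exists N => // n /= Nn; exists n.
move=> [_ _] /= [[m Nm <-] [n Nn <-]].
by rewrite -ball_normE /= normE eE lt_cR hN.
Qed.

End RealHilbert.

(** * Limits and orthogonal projections *)

Section Convergence.
Context (R : realType) (H : hilbertType R).
Implicit Types (u v w : H) (a b : R) (s : nat -> H).

Lemma conv_dom (e : nat -> R) s u :
  e @ \oo --> (0 : R) -> (forall n, nr (s n - u) <= e n) -> conv s u.
Proof.
move=> e0 se; apply: (squeeze_cvgr _ (cvg_cst 0) e0).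
by apply: nearW => n; rewrite nr_ge0 se.
Qed.

Lemma conv_uniq s u v : conv s u -> conv s v -> u = v.
Proof. by move=> /conv_cvg su /conv_cvg sv; exact: cvg_unique su sv. Qed.

Lemma conv_cst u : conv (fun=> u) u.
Proof.
by apply: (@conv_dom (fun=> 0)) => [|n]; [exact: cvg_cst | rewrite subrr nr0].
Qed.

Lemma conv_lip (K : R) s u (s' : nat -> H) u' : conv s u ->
  (forall n, nr (s' n - u') <= K * nr (s n - u)) -> conv s' u'.
Proof.
move=> su; apply: conv_dom; rewrite -(mulr0 K); apply: cvgM su; exact: cvg_cst.
Qed.

Lemma convD s u (s' : nat -> H) u' :
  conv s u -> conv s' u' -> conv (fun n => s n + s' n) (u + u').
Proof.
move=> su su'; apply: (@conv_dom (fun n => nr (s n - u) + nr (s' n - u'))).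
  by rewrite -(addr0 0); apply: cvgD.
by move=> n; rewrite opprD addrACA nrD.
Qed.

Lemma convN s u : conv s u -> conv (fun n => - s n) (- u).
Proof.
by move=> su; apply: (conv_lip (K := 1)) su _ => n; rewrite -opprD nrN mul1r.
Qed.

Lemma convB s u (s' : nat -> H) u' :
  conv s u -> conv s' u' -> conv (fun n => s n - s' n) (u - u').
Proof. by move=> su su'; apply: convD => //; exact: convN. Qed.

Lemma nr_lip u v : `|nr u - nr v| <= nr (u - v).
Proof.
rewrite ler_distl; have := nrD (u - v) v; have := nrD (v - u) u.
by rewrite !subrK (nrC v u); lra.
Qed.

Lemma conv_nr s u : conv s u -> (nr (s n) @[n --> \oo]) --> nr u.
Proof.
move=> su; apply/cvgrPdist_le => e e0; move/cvgrPdist_le: su => /(_ _ e0).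
apply: filterS => n; rewrite sub0r normrN ger0_norm ?nr_ge0 // => h.
by rewrite distrC (le_trans (nr_lip _ _)).
Qed.

Lemma conv_rip s u v : conv s u -> (rip (s n) v @[n --> \oo]) --> rip u v.
Proof.
move=> su; have : (nr (s n - u) * nr v @[n --> \oo]) --> (0 : R).
  by rewrite -(mul0r (nr v)); apply: cvgM su _; exact: cvg_cst.
move=> /cvgrPdist_le h; apply/cvgrPdist_le => e e0; have := h _ e0.
apply: filterS => n; rewrite sub0r normrN ger0_norm ?mulr_ge0 ?nr_ge0 // => hn.
by rewrite distrC -ripNl -ripDl (le_trans (rip_abs _ _)).
Qed.

Lemma conv_nr_le s u (K : R) : conv s u -> (forall n, nr (s n) <= K) -> nr u <= K.
Proof.
move=> /conv_nr su sK; rewrite -(cvg_lim _ su) //.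
by apply: limr_le; [apply/cvg_ex; exists (nr u) | apply: nearW].
Qed.

Section Projection.
Context (T : finType).
Implicit Types x y z : T -> H.

(** Inner product of the Hilbert sum of copies of [H] indexed by [T]. The Riesz theorem uses
    [T = unit], the independence of automorphisms uses the finite group. *)
Definition rips x y : R := \sum_t rip (x t) (y t).

Lemma ripsDl x y z : rips (x + y) z = rips x z + rips y z.
Proof. by rewrite /rips -big_split; apply: eq_bigr => t _; rewrite ripDl. Qed.

Lemma ripsC x y : rips x y = rips y x.
Proof. by apply: eq_bigr => t _; rewrite ripC. Qed.

Lemma ripsNl x y : rips (- x) y = - rips x y.
Proof. by rewrite /rips -sumrN; apply: eq_bigr => t _; rewrite ripNl. Qed.

Lemma ripsZl a x y : rips (cR a *: x) y = a * rips x y.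
Proof. by rewrite /rips mulr_sumr; apply: eq_bigr => t _; rewrite ripZl. Qed.

Lemma ripsDr x y z : rips z (x + y) = rips z x + rips z y.
Proof. by rewrite ripsC ripsDl !(ripsC z). Qed.

Lemma ripsNr x y : rips x (- y) = - rips x y.
Proof. by rewrite ripsC ripsNl ripsC. Qed.

Lemma ripsZr a x y : rips x (cR a *: y) = a * rips x y.
Proof. by rewrite ripsC ripsZl ripsC. Qed.

Lemma ripsBZ a x z : rips (x - cR a *: z) (x - cR a *: z) =
  rips x x - 2 * a * rips x z + a ^+ 2 * rips z z.
Proof.
by rewrite !(ripsDl, ripsDr, ripsNl, ripsNr, ripsZl, ripsZr) (ripsC z x); ring.
Qed.

Lemma nr_rips x t : nr (x t) ^+ 2 <= rips x x.
Proof.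
rewrite /rips (bigD1 t) //= ripE lerDl sumr_ge0 // => i _.
by rewrite ripE sqr_ge0.
Qed.

Lemma rips_ge0 x : 0 <= rips x x.
Proof. by apply: sumr_ge0 => t _; rewrite ripE sqr_ge0. Qed.

Lemma rips_eq0 x : rips x x = 0 -> x = 0.
Proof.
move=> e; apply/funext => t; apply/nr_eq0/eqP; rewrite -sqrf_eq0.
by rewrite eq_le sqr_ge0 andbT -e nr_rips.
Qed.

Definition real_subspace (S : set (T -> H)) :=
  [/\ S 0, forall x y, S x -> S y -> S (x + y),
      forall a x, S x -> S (cR a *: x) &
      forall (s : nat -> T -> H) x,
        (forall n, S (s n)) -> (forall t, conv (s ^~ t) (x t)) -> S x].

Lemma projection_exists (S : set (T -> H)) : real_subspace S ->
  forall x, exists2 p, S p & forall z, S z -> rips (x - p) z = 0.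
Proof.
move=> [S0 SD SZ Scl] x.
pose D := [set rips (x - z) (x - z) | z in S].
have infD : has_inf D.
  split; first by exists (rips (x - 0) (x - 0)); exists 0.
  by exists 0 => _ [z _ <-]; exact: rips_ge0.
pose d := inf D.
have dle z : S z -> d <= rips (x - z) (x - z).
  by move=> Sz; apply: (ge_inf infD.2); exists z.
have /choice[s hs] : forall n : nat, exists z,
    S z /\ rips (x - z) (x - z) < d + n.+1%:R^-1.
  move=> n; have n0 : 0 < (n.+1%:R^-1 : R) by rewrite invr_gt0.
  by have [_ [z Sz <-] lt] := inf_adherent n0 infD; exists z.
have scauchy m n : rips (s m - s n) (s m - s n) <=
    2 * (m.+1%:R^-1 + n.+1%:R^-1).
  have [Sm lm] := hs m; have [Sn ln] := hs n.
  (* The midpoint of [s m] and [s n] lies in [S]; the parallelogram law turns its distance from [x]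
     into a Cauchy estimate. *)
  have := dle _ (SZ 2^-1 _ (SD _ _ Sm Sn)).
  move: lm ln; rewrite !(ripsDl, ripsDr, ripsNl, ripsNr, ripsZl, ripsZr).
  rewrite (ripsC (s m) x) (ripsC (s n) x) (ripsC (s n) (s m)).
  move: (rips x x) (rips x (s m)) (rips x (s n)) (rips (s m) (s m)).
  move: (rips (s m) (s n)) (rips (s n) (s n)) m.+1%:R^-1 n.+1%:R^-1.
  by move=> *; lra.
have cvt t : exists u, conv (s ^~ t) u.
  apply: conv_complete => e e0.
  have e20 : 0 < e ^+ 2 / 4 by rewrite divr_gt0 ?exprn_gt0.
  have [N _ hN] : \forall n \near \oo, (n.+1%:R^-1 : R) < e ^+ 2 / 4.
    move/cvgrPdist_lt: (@cvg_harmonic R) => /(_ _ e20); apply: filterS => n.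
    by rewrite sub0r normrN ger0_norm // invr_ge0.
  exists N => m n Nm Nn; rewrite -ltr_sqr ?nnegrE ?nr_ge0 ?(ltW e0) //.
  apply: (le_lt_trans (nr_rips (s m - s n) t)).
  apply: (le_lt_trans (scauchy m n)).
  have := hN _ Nm; have := hN _ Nn; rewrite /=.
  by move: m.+1%:R^-1 n.+1%:R^-1 (e ^+ 2) => *; lra.
have [p hp] := choice cvt.
have Sp : S p by apply: (Scl s) => // n; have [] := hs n.
exists p => // z Sz.
have dp : rips (x - p) (x - p) <= d.
  have c1 : (rips (x - s n) (x - s n) @[n --> \oo]) --> rips (x - p) (x - p).
    rewrite /rips; apply: cvg_big => [|t _]; first exact: add_continuous.
    under eq_fun do rewrite ripE; rewrite ripE.
    have : conv (fun n => (x - s n) t) ((x - p) t).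
      by apply: convB; [exact: conv_cst | exact: hp].
    by move=> /conv_nr c; rewrite expr2; under eq_fun do rewrite expr2; apply: cvgM.
  have c2 : (d + (n.+1%:R^-1 : R) @[n --> \oo]) --> d.
    rewrite -[X in _ --> X]addr0; apply: cvgD; first exact: cvg_cst.
    exact: cvg_harmonic.
  rewrite -(cvg_lim _ c1) // -(cvg_lim _ c2) //; apply: ler_lim.
  - by apply/cvg_ex; eexists; exact: c1.
  - by apply/cvg_ex; eexists; exact: c2.
  - by apply: nearW => n; have [_ /ltW] := hs n.
have key a : 0 <= - (2 * a * rips (x - p) z) + a ^+ 2 * rips z z.
  have := dle _ (SD _ _ Sp (SZ a _ Sz)).
  rewrite opprD addrA.
  by move: dp; rewrite ripsBZ; lra.
have [z0|z0] := eqVneq (rips z z) 0.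
  by have /= := rips_eq0 z0 => ->; rewrite ripsC -(subrr z) ripsDl ripsNl subrr.
(* The minimizer of the quadratic in [key], where its value is [- (A ^+ 2 / Z)]. *)
have := key (rips (x - p) z / rips z z).
set A := rips (x - p) z; set Z := rips z z in z0 *.
have -> : - (2 * (A / Z) * A) + (A / Z) ^+ 2 * Z = - (A ^+ 2 / Z) by field.
rewrite oppr_ge0 => h; apply/eqP; rewrite -sqrf_eq0; apply/eqP.
have Z0 : 0 < Z by rewrite lt_def z0 rips_ge0.
by apply: le_anti; rewrite sqr_ge0 andbT; move: h; rewrite ler_pdivrMr // mul0r.
Qed.

End Projection.
End Convergence.

(** * Bounded operators and adjoints *)

Section BoundedOperators.
Context (R : realType) (H : hilbertType R).
Local Notation C := (cplx R).
Local Notation op := (H -> H).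
Implicit Types (u v w : H) (x y : op) (c : C).

Lemma linD x : linear x -> forall u v, x (u + v) = x u + x v.
Proof. by move=> lx u v; have := lx 1 u v; rewrite !scale1r. Qed.

Lemma lin0 x : linear x -> x 0 = 0.
Proof. by move=> lx; apply: (addrI (x 0)); rewrite -linD // !addr0. Qed.

Lemma linZ x : linear x -> forall c u, x (c *: u) = c *: x u.
Proof. by move=> lx c u; rewrite -[c *: u]addr0 lx lin0 // addr0. Qed.

Lemma linN x : linear x -> forall u, x (- u) = - x u.
Proof. by move=> lx u; rewrite -scaleN1r linZ // scaleN1r. Qed.

Let pack_linear x (lx : linear x) : {linear H -> H}
  := HB.pack x (GRing.isLinear.Build _ _ _ _ _ lx).

Lemma bounded_opP x : bounded_op x <->
  linear x /\ exists2 K : R, 0 <= K & forall u, nr (x u) <= K * nr u.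
Proof.
split=> [[lx cx]|[lx [K K0 xK]]]; split=> //.
  have /linear_bounded_continuous/linear_boundedP : continuous (pack_linear lx).
    exact: cx.
  move=> /pinfty_ex_gt0[k k0 hk].
  have kE := cR_ReE (ltW k0).
  exists (complex.Re (k : R[i])) => [|u]; first by rewrite -le_cR -kE ltW.
  have := hk u; rewrite !normE kE /=.
  by rewrite -[cR _ * cR _]rmorphM /= => /[!lecR].
suff : continuous (pack_linear lx) by [].
apply/linear_bounded_continuous/linear_boundedP; near=> r => u.
rewrite !normE /= (le_trans (y := cR K * cR (nr u))) //.
  by rewrite -[_ * _]rmorphM lecR xK.
apply: ler_wpM2r; first by rewrite -normE.
by near: r; apply: nbhs_pinfty_ge; rewrite realE lecR K0.
Unshelve. all: by end_near. Qed.

Lemma rip_i u v : rip ('i *: u) v = - rip u ('i *: v).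
Proof.
rewrite /rip linearZl_LR linearZr_LR /= conjCi.
have -> : 'i = ('i)%C :> C by [].
by case: (inner u v) => a b /=; ring.
Qed.

Lemma rip_conjZ c u v : rip (c *: u) v = rip u (c^* *: v).
Proof. by rewrite /rip linearZl_LR linearZr_LR /= conjCK. Qed.

(** The imaginary part of the inner product is a real part after rotation by ['i], and complex
    linearity of [x] moves the rotation across. *)
Lemma inner_rip x y : linear x -> (forall u v, rip (x u) v = rip u (y v)) ->
  forall u v, inner (x u) v = inner u (y v).
Proof.
move=> lx xy u v; rewrite !innerE xy; congr (_ +i* _)%C.
by apply: oppr_inj; rewrite -!rip_i -linZ // xy.
Qed.

Lemma adj_unique x y : linear x -> (forall u v, rip (x u) v = rip u (y v)) ->
  adj x = y.
Proof.
move=> lx /(inner_rip lx) xy; rewrite /adj; apply: xget_unique => // z xz.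
apply/funext => v; apply: rip_inj => w.
by rewrite /rip -xz -xy.
Qed.

Lemma riesz (f : H -> R) :
  (forall u v, f (u + v) = f u + f v) -> (forall a u, f (cR a *: u) = a * f u) ->
  (exists2 K, 0 <= K & forall u, `|f u| <= K * nr u) ->
  exists v, forall u, f u = rip u v.
Proof.
move=> fD fZ [K K0 fK].
have f0 : f 0 = 0 by apply: (addrI (f 0)); rewrite -fD !addr0.
have [[u0 fu0]|nf] := pselect (exists u, f u != 0); last first.
  exists 0 => u; rewrite rip0r; apply: contrapT => /eqP fu.
  by apply: nf; exists u.
pose S : set (unit -> H) := [set z | f (z tt) = 0].
have SS : real_subspace S.
  split; rewrite /S //=.
  - by move=> z z'; rewrite fD => -> ->; rewrite addr0.
  - by move=> a z; rewrite fZ => ->; rewrite mulr0.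
  - move=> s z hs /(_ tt) sz.
    have nfz n : 0 <= `|f (z tt)| <= K * nr (s n tt - z tt).
      rewrite normr_ge0 /= nrC -[f _]addr0 -(hs n) .
      rewrite -{1}[z tt](subrK (s n tt)) fD hs !addr0.
      exact: fK.
    have c0 : (K * nr (s n tt - z tt) @[n --> \oo]) --> (0 : R).
      by rewrite -(mulr0 K); apply: cvgM sz; exact: cvg_cst.
    apply/eqP; rewrite -normr_le0 -(cvg_lim _ c0) //; apply: limr_ge.
      by apply/cvg_ex; exists 0.
    by apply: nearW => n; have /andP[] := nfz n.
have [p Sp hp] := projection_exists SS (fun=> u0).
pose w := u0 - p tt.
have fw : f w = f u0.
  by have := fD w (p tt); rewrite subrK (_ : f (p tt) = 0) // addr0.
have w0 : nr w != 0.
  by apply: contra fu0 => /eqP/nr_eq0 w0; rewrite -fw w0 f0.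
(* [w] is orthogonal to the kernel of [f], which contains [u - (f u / f w) w]. *)
exists (cR (f w / nr w ^+ 2) *: w) => u.
have fwN0 : f w != 0 by rewrite fw.
have : rips ((fun=> u0) - p) (fun=> u - cR (f u / f w) *: w) = 0.
  apply: hp; rewrite /S /= fD -scaleNr.
  rewrite (_ : - cR _ = cR (- (f u / f w))); last by rewrite /cR rmorphN.
  by rewrite fZ mulNr divfK // subrr.
rewrite /rips (big_pred1 tt); last by case.
rewrite [_ tt]/= -/w ripDr ripNr !ripZr ripE ripC => /eqP.
rewrite subr_eq0 => /eqP ->.
by rewrite -[((fun=> u0) - p) tt]/w; field; rewrite w0 fwN0.
Qed.

Lemma adjP x : bounded_op x -> forall u v, rip (x u) v = rip u (adj x v).
Proof.
move=> /bounded_opP[lx [K K0 xK]].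
have /choice[y hy] : forall v, exists w, forall u, rip (x u) v = rip u w.
  move=> v; apply: riesz => [u w|a u|]; first by rewrite linD // ripDl.
    by rewrite linZ // ripZl.
  exists (K * nr v) => [|u]; first by rewrite mulr_ge0 ?nr_ge0.
  by rewrite (le_trans (rip_abs _ _)) // mulrAC ler_wpM2r ?nr_ge0.
have xy u v : rip (x u) v = rip u (y v) by rewrite hy.
by rewrite (adj_unique lx xy).
Qed.

Lemma bounded_adj x : bounded_op x -> bounded_op (adj x).
Proof.
move=> bx; have xa := adjP bx; have /bounded_opP[lx [K K0 xK]] := bx.
apply/bounded_opP; split=> [c u v|].
  apply: rip_inj => w; rewrite -xa !ripDr -xa; congr (_ + _).
  rewrite -[c in RHS]conjCK -rip_conjZ -xa linZ //.
  by rewrite rip_conjZ conjCK.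
exists K => // u; have [->|u0] := eqVneq (nr (adj x u)) 0.
  by rewrite mulr_ge0 ?nr_ge0.
have p0 : 0 < nr (adj x u) by rewrite lt_def u0 nr_ge0.
rewrite -(ler_pM2l p0) -expr2 -ripE -xa (le_trans (rip_le _ _)) //.
by rewrite mulrA ler_wpM2r ?nr_ge0 // mulrC xK.
Qed.

Lemma adjK x : bounded_op x -> adj (adj x) = x.
Proof.
move=> bx; have [la _] := bounded_adj bx.
by apply: adj_unique => // u v; rewrite ripC -adjP // ripC.
Qed.

Lemma adj_comp x y : bounded_op x -> bounded_op y -> adj (x \o y) = adj y \o adj x.
Proof.
move=> bx by_; have [[lx _] [ly _]] := (bx, by_).
apply: adj_unique => [c u v /=|u v /=]; first by rewrite ly lx.
by rewrite !adjP.
Qed.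

Lemma bounded_comp x y : bounded_op x -> bounded_op y -> bounded_op (x \o y).
Proof.
move=> /bounded_opP[lx [K K0 xK]] /bounded_opP[ly [L L0 yL]].
apply/bounded_opP; split=> [c u v /=|]; first by rewrite ly lx.
exists (K * L) => [|u /=]; first exact: mulr_ge0.
by rewrite (le_trans (xK _)) // -mulrA ler_wpM2l.
Qed.

Lemma bounded_id : bounded_op (idfun : op).
Proof. by apply/bounded_opP; split=> //; exists 1 => // u; rewrite mul1r. Qed.

Lemma nrZ_le c : exists2 K : R, 0 <= K & forall u, nr (c *: u) <= K * nr u.
Proof.
exists (complex.Re (`|c| : R[i])) => [|w].
  by rewrite -le_cR -cR_ReE ?normr_ge0.
rewrite -lecR -[X in _ <= X]/(cR _) -[X in X <= _]/(cR _) -normE normrZ normE.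
by rewrite /cR rmorphM /= -[_%:C%C]/(cR _) -cR_ReE.
Qed.

Lemma bounded_lin c x y : bounded_op x -> bounded_op y -> bounded_op (c *: x + y).
Proof.
move=> /bounded_opP[lx [K K0 xK]] /bounded_opP[ly [L L0 yL]].
apply/bounded_opP; split=> [d u v|].
  rewrite [LHS]/= -[(c *: x + y) _]/(c *: x _ + y _).
  rewrite -[(c *: x + y) u]/(c *: x _ + y _) -[(c *: x + y) v]/(c *: x _ + y _).
  by rewrite lx ly !scalerDr !scalerA (mulrC c d) !addrA (addrAC _ (c *: x v)).
have [k k0 hk] := nrZ_le c.
exists (k * K + L) => [|u]; first by rewrite addr_ge0 ?mulr_ge0.
rewrite -[(c *: x + y) _]/(c *: x _ + y _) (le_trans (nrD _ _)) // mulrDl.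
by rewrite lerD // (le_trans (hk _)) // -mulrA ler_wpM2l.
Qed.

End BoundedOperators.

(** * A von Neumann algebra as a ring with involution *)

Section Membership.
Context (R : realType) (H : hilbertType R) (M : set (H -> H)).
Hypothesis hM : von_neumann_algebra M.
Local Notation C := (cplx R).
Implicit Types (u v w : H) (x y : H -> H) (c : C).

Lemma vn_bounded x : M x -> bounded_op x.
Proof. by rewrite -hM.2 => -[]. Qed.

(** The form in which the bicommutant condition is used: limits and matrix entries are shown to
    commute with the commutant. *)
Lemma vn_intro x : bounded_op x ->
  (forall y, commutant M y -> forall u, x (y u) = y (x u)) -> M x.
Proof.
move=> bx xy; rewrite -hM.2; split=> // y cy; apply/funext => u; exact: xy.
Qed.

Lemma vn_comm x y : M x -> commutant M y -> forall u, x (y u) = y (x u).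
Proof. by move=> Mx [_ cy] u; have /(congr1 (@^~ u)) := cy _ Mx. Qed.

Lemma vn_linear x : M x -> linear x.
Proof. by move=> /vn_bounded[]. Qed.

Lemma vn_id : M idfun.
Proof. by apply: vn_intro => //; exact: bounded_id. Qed.

Lemma vn_comp x y : M x -> M y -> M (x \o y).
Proof.
move=> Mx My; apply: vn_intro => [|z cz u /=].
  by apply: bounded_comp; exact: vn_bounded.
by rewrite (vn_comm My) // (vn_comm Mx).
Qed.

Lemma vn_lin c x y : M x -> M y -> M (c *: x + y).
Proof.
move=> Mx My; apply: vn_intro => [|z cz u].
  by apply: bounded_lin; exact: vn_bounded.
rewrite -![(c *: x + y) _]/(c *: x _ + y _) (vn_comm Mx) // (vn_comm My) //.
by case: cz => [[lz _] _]; rewrite lz.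
Qed.

Lemma vn_adj x : M x -> M (adj x).
Proof. exact: hM.1. Qed.

Lemma vn_zero : M (0 : H -> H).
Proof.
rewrite -(subrr (idfun : H -> H)) addrC -scaleN1r; exact: vn_lin vn_id vn_id.
Qed.

Lemma vn_add x y : M x -> M y -> M (x + y).
Proof. by move=> Mx My; rewrite -[x]scale1r; exact: vn_lin. Qed.

Lemma vn_opp x : M x -> M (- x).
Proof. by move=> Mx; rewrite -[- x]addr0 -scaleN1r; exact: vn_lin vn_zero. Qed.

Lemma vn_scale c x : M x -> M (c *: x).
Proof. by move=> Mx; rewrite -[c *: x]addr0; exact: vn_lin vn_zero. Qed.

Lemma commutant_adj x : commutant M x -> commutant M (adj x).
Proof.
move=> [bx cx]; split=> [|y My]; first exact: bounded_adj.
have by_ := vn_bounded My; have := cx _ (vn_adj My) => /(congr1 (@adj R H)).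
rewrite (adj_comp bx (bounded_adj by_)) (adj_comp (bounded_adj by_) bx).
by rewrite (adjK by_).
Qed.

End Membership.

Section Algebra.
Context (R : realType) (H : hilbertType R) (M : set (H -> H)).
Local Notation C := (cplx R).

(** Bundled membership turns [M] into a ring, possibly zero, so that operator identities become ring
    computations. *)
Record vna (hM : von_neumann_algebra M) :=
  Vna { vop :> H -> H; vopP : M vop }.

Context (hM : von_neumann_algebra M).
Local Notation A := (vna hM).
Implicit Types (a b : A) (u v : H) (c : C).

HB.instance Definition _ := gen_eqMixin A.
HB.instance Definition _ := gen_choiceMixin A.

Let mkv x (Mx : M x) : A := Vna hM Mx.

Lemma vop_inj a b : vop a = vop b -> a = b.
Proof.
case: a b => [x Mx] [y My] /= e; case: y / e My => My.
by rewrite (Prop_irrelevance Mx My).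
Qed.

Lemma vna_ext a b : (forall u, a u = b u) -> a = b.
Proof. by move=> /funext/vop_inj. Qed.

Let add a b : A := mkv (vn_add hM (vopP a) (vopP b)).
Let opp a : A := mkv (vn_opp hM (vopP a)).
Let zero : A := mkv (vn_zero hM).
Let one : A := mkv (vn_id hM).
Let mul a b : A := mkv (vn_comp hM (vopP a) (vopP b)).

Lemma vop_lin a : linear a. Proof. exact: vn_linear (vopP a). Qed.

Let addA : associative add.
Proof. by move=> a b d; apply: vna_ext => u; exact: addrA. Qed.
Let addC : commutative add.
Proof. by move=> a b; apply: vna_ext => u; exact: addrC. Qed.
Let add0 : left_id zero add.
Proof. by move=> a; apply: vna_ext => u; exact: add0r. Qed.
Let addN : left_inverse zero opp add.
Proof. by move=> a; apply: vna_ext => u; exact: addNr. Qed.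

HB.instance Definition _ := GRing.isZmodule.Build A addA addC add0 addN.

Let mulA : associative mul. Proof. by move=> a b d; exact: vna_ext. Qed.
Let mul1 : left_id one mul. Proof. by move=> a; exact: vna_ext. Qed.
Let mulx1 : right_id one mul. Proof. by move=> a; exact: vna_ext. Qed.
Let mulDl : left_distributive mul +%R.
Proof. by move=> a b d; exact: vna_ext. Qed.
Let mulDr : right_distributive mul +%R.
Proof. by move=> a b d; apply: vna_ext => u; exact: linD (vop_lin a) _ _. Qed.

HB.instance Definition _ :=
  GRing.Zmodule_isPzRing.Build A mulA mul1 mulx1 mulDl mulDr.

Lemma vopM a b u : (a * b) u = a (b u). Proof. by []. Qed.
Lemma vopD a b u : (a + b) u = a u + b u. Proof. by []. Qed.
Lemma vopN a u : (- a) u = - a u. Proof. by []. Qed.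
Lemma vopB a b u : (a - b) u = a u - b u. Proof. by []. Qed.
Lemma vop1 u : (1 : A) u = u. Proof. by []. Qed.
Lemma vop0 u : (0 : A) u = 0. Proof. by []. Qed.
Lemma vop_add a u v : a (u + v) = a u + a v. Proof. exact: linD (vop_lin a) _ _. Qed.
Lemma vop_opp a u : a (- u) = - a u. Proof. exact: linN (vop_lin a) _. Qed.
Lemma vop_sub a u v : a (u - v) = a u - a v.
Proof. by rewrite vop_add vop_opp. Qed.

Lemma vop_sum (I : Type) (r : seq I) (P : pred I) (F : I -> A) u :
  (\sum_(i <- r | P i) F i) u = \sum_(i <- r | P i) F i u.
Proof. by elim/big_rec2: _ => // i _ b _ <-. Qed.

Definition star a : A := mkv (vn_adj hM (vopP a)).

Lemma rip_star a u v : rip (a u) v = rip u (star a v).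
Proof. exact: adjP (vn_bounded hM (vopP a)) _ _. Qed.

Lemma rip_starl a u v : rip (star a u) v = rip u (a v).
Proof. by rewrite ripC -rip_star ripC. Qed.

Lemma star_eq a b : (forall u v, rip (a u) v = rip u (b v)) -> star a = b.
Proof.
move=> ab; apply: vna_ext => u; apply: rip_inj => w.
by rewrite -rip_star ab.
Qed.

Lemma starK : involutive star.
Proof. by move=> a; apply: star_eq => u v; rewrite rip_starl. Qed.

Lemma starM a b : star (a * b) = star b * star a.
Proof. by apply: star_eq => u v; rewrite !vopM !rip_star. Qed.

Lemma starD a b : star (a + b) = star a + star b.
Proof. by apply: star_eq => u v; rewrite !vopD ripDl ripDr !rip_star. Qed.

Lemma starN a : star (- a) = - star a.
Proof. by apply: star_eq => u v; rewrite !vopN ripNl ripNr rip_star. Qed.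

Lemma starB a b : star (a - b) = star a - star b.
Proof. by rewrite starD starN. Qed.

Lemma star1 : star 1 = 1. Proof. exact: star_eq. Qed.

Lemma star0 : star 0 = 0.
Proof. by apply: star_eq => u v; rewrite !vop0 rip0l rip0r. Qed.

Definition sc c : A := mkv (vn_scale hM c (vn_id hM)).

Lemma scE c u : sc c u = c *: u. Proof. by []. Qed.

Lemma sc_comm c a : sc c * a = a * sc c.
Proof. by apply: vna_ext => u; rewrite !vopM !scE (linZ (vop_lin a)). Qed.

Lemma star_sc c : star (sc c) = sc c^*.
Proof. by apply: star_eq => u v; rewrite !scE rip_conjZ. Qed.

Lemma scM c d : sc (c * d) = sc c * sc d.
Proof. by apply: vna_ext => u; rewrite vopM !scE scalerA. Qed.

Lemma scD c d : sc (c + d) = sc c + sc d.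
Proof. by apply: vna_ext => u; rewrite vopD !scE scalerDl. Qed.

Lemma sc1 : sc 1 = 1.
Proof. by apply: vna_ext => u; rewrite scE scale1r. Qed.

Lemma vop_bound a : exists2 K : R, 0 <= K & forall u, nr (a u) <= K * nr u.
Proof. by have /bounded_opP[] := vn_bounded hM (vopP a). Qed.

Lemma nr_star a u : nr (a u) ^+ 2 = rip ((star a * a) u) u.
Proof. by rewrite -ripE vopM rip_starl. Qed.

Lemma vop_conv a s u : conv s u -> conv (fun n => a (s n)) (a u).
Proof.
have [K _ aK] := vop_bound a.
by move=> su; apply: (conv_lip (K := K)) su _ => n; rewrite -vop_sub.
Qed.

Lemma star_comp0 a : star a * a = 0 -> a = 0.
Proof.
move=> e; apply: vna_ext => u; apply: nr_eq0; apply/eqP.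
by rewrite -sqrf_eq0 nr_star e vop0 rip0l.
Qed.

(** Linearity, the uniform bound and commutation with the commutant survive pointwise limits, so the
    bicommutant condition keeps the limit in [M]. *)
Lemma strong_limit (s : nat -> A) (f : H -> H) (K : R) :
  (forall n u, nr (s n u) <= K * nr u) ->
  (forall u, conv (fun n => s n u) (f u)) -> exists a, vop a = f.
Proof.
move=> sK sf.
have lf : linear f.
  move=> c u v; apply: (conv_uniq (sf _)).
  under [X in conv X]eq_fun do rewrite (vop_lin (s _)).
  apply: convD (sf v).
  have [k _ hk] := @nrZ_le R H c.
  by apply: (conv_lip (K := k)) (sf u) _ => n; rewrite -scalerBr.
have Mf : M f.
  apply: (vn_intro hM).
    apply/bounded_opP; split=> //; exists `|K| => [|u]; first exact: normr_ge0.
    apply: (conv_nr_le (sf u)) => n; rewrite (le_trans (sK n u)) //.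
    by rewrite ler_wpM2r ?nr_ge0 // ler_norm.
  move=> y cy u; apply: (conv_uniq (sf _)).
  have /bounded_opP[ly [L _ yL]] := cy.1.
  under [X in conv X]eq_fun do rewrite (vn_comm (vopP (s _)) cy).
  apply: (conv_lip (K := L)) (sf u) _ => n.
  by rewrite -(linN ly) -(linD ly).
by exists (mkv Mf).
Qed.

End Algebra.

Arguments vop : simpl never.

(** * Square roots *)

Section Contractions.
Context (R : realType) (H : hilbertType R) (M : set (H -> H)).
Context (hM : von_neumann_algebra M).
Local Notation C := (cplx R).
Local Notation A := (vna hM).
Implicit Types (a b c y z : A) (u v w : H).

Definition contractive a := forall u, nr (a u) <= nr u.

Lemma contractive_star a : contractive a -> contractive (star a).
Proof.
move=> ca u; have [e|n0] := eqVneq (nr (star a u)) 0; first by rewrite e nr_ge0.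
have p0 : 0 < nr (star a u) by rewrite lt_def n0 nr_ge0.
rewrite -(ler_pM2l p0) -expr2 -ripE rip_starl (le_trans (rip_le _ _)) //.
by rewrite mulrC ler_wpM2r ?nr_ge0.
Qed.

(** Polarization: the real bilinear form [rip (b u) v] is symmetric because [b] is self-adjoint. *)
Lemma sa_eq0 b : star b = b -> (forall u, rip (b u) u = 0) -> b = 0.
Proof.
move=> sb bu; apply: vna_ext => u; apply: rip_inj => v; rewrite rip0r.
have := bu (u + v); rewrite vop_add ripDl !ripDr !bu addr0 add0r.
by rewrite -[in rip (b v) _]sb rip_starl (ripC v) (ripC (b u)) => e; lra.
Qed.

Lemma rip_conv_eq (f g : nat -> H) u v w w' : conv f u -> conv g v ->
  (forall n, rip (f n) w = rip (g n) w') -> rip u w = rip v w'.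
Proof.
move=> /(@conv_rip _ _ _ _ w) fu /(@conv_rip _ _ _ _ w') gv fg.
by rewrite -(cvg_lim _ fu) // -(cvg_lim _ gv) //; under eq_fun do rewrite fg.
Qed.

(* For a contraction [c] the iterates of [y |-> (c + y ^+ 2) / 2] converge in
   norm to [1 - sqrt (1 - c)], the scalar case [c = 1] giving the rate. *)
Fixpoint sqrt_iter c n : A :=
  if n is m.+1 then sc hM 2^-1 * (c + sqrt_iter c m * sqrt_iter c m) else 0.

Fixpoint sqrt_rate n : R :=
  if n is m.+1 then 2^-1 * (1 + sqrt_rate m ^+ 2) else 0.

Lemma sqrt_rate_bounds n : 0 <= sqrt_rate n <= sqrt_rate n.+1 /\ sqrt_rate n <= 1.
Proof.
elim: n => [|n [/andP[h0 h1] h2]] /=; first by split; lra.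
move: h1 => /=; set r := sqrt_rate n in h0 h2 *; split; last by nra.
by apply/andP; split; nra.
Qed.

Lemma nondecreasing_sqrt_rate : nondecreasing_seq sqrt_rate.
Proof.
by apply/nondecreasing_seqP => n; have [/andP[]] := sqrt_rate_bounds n.
Qed.

Lemma is_cvg_sqrt_rate : cvgn sqrt_rate.
Proof.
apply: nondecreasing_is_cvgn; first exact: nondecreasing_sqrt_rate.
by exists 1 => _ [n _ <-]; have [] := sqrt_rate_bounds n.
Qed.

Lemma comm_sc (k : C) b : GRing.comm b (sc hM k).
Proof. exact/esym/sc_comm. Qed.

Lemma comm_sqrt_iter c b n : GRing.comm b c -> GRing.comm b (sqrt_iter c n).
Proof.
move=> bc; elim: n => [|n IH] /=; first exact: commr0.
apply: commrM; first exact: comm_sc.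
by apply: commrD => //; apply: commrM.
Qed.

Lemma star_sqrt_iter c n : star c = c -> star (sqrt_iter c n) = sqrt_iter c n.
Proof.
move=> sac; elim: n => [|n IH] /=; first exact: star0.
rewrite starM starD starM IH sac star_sc sc_comm; congr (_ * sc _ _).
by rewrite geC0_conj // invr_ge0.
Qed.

Lemma scR_half : sc hM (2^-1 : C) = sc hM (cR 2^-1).
Proof. by congr sc; rewrite /cR fmorphV rmorphMn. Qed.

Lemma nr_half u : nr (sc hM (2^-1 : C) u) = 2^-1 * nr u.
Proof. by rewrite scR_half scE nrZ ger0_norm // invr_ge0. Qed.

Lemma nr_sqrt_iter c n u : contractive c ->
  nr (sqrt_iter c n u) <= sqrt_rate n * nr u.
Proof.
move=> cc; elim: n u => [|n IH] u /=; first by rewrite vop0 nr0 mul0r.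
rewrite vopM nr_half vopD vopM -mulrA ler_pM2l ?invr_gt0 //.
rewrite (le_trans (nrD _ _)) // mulrDl mul1r lerD //.
rewrite (le_trans (IH _)) // expr2 -mulrA ler_wpM2l //.
by have [/andP[]] := sqrt_rate_bounds n.
Qed.

(** The iterates commute, so successive differences factor as [y'' - y' = (y' + y) (y' - y) / 2];
    the rates obey the same recursion. *)
Lemma nr_sqrt_iterS c n u : contractive c ->
  nr ((sqrt_iter c n.+1 - sqrt_iter c n) u) <=
  (sqrt_rate n.+1 - sqrt_rate n) * nr u.
Proof.
move=> cc; elim: n u => [|n IH] u.
  rewrite /= mulr0 addr0 subr0 vopM nr_half expr0n addr0 mulr1 subr0.
  by rewrite ler_pM2l ?invr_gt0.
set y := sqrt_iter c n; set y' := sqrt_iter c n.+1.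
have yy' : GRing.comm y y'.
  by apply: comm_sqrt_iter; exact/commr_sym/comm_sqrt_iter.
have -> : sqrt_iter c n.+2 - y' = sc hM 2^-1 * ((y' + y) * (y' - y)).
  rewrite /y' [sqrt_iter c n.+2]/= [in X in _ - X]/= -/y' -/y -mulrBr.
  congr (_ * _); rewrite mulrBr !mulrDl yy' opprD addrACA subrr add0r opprD.
  by rewrite addrA addrK.
have -> : sqrt_rate n.+2 - sqrt_rate n.+1 =
    2^-1 * ((sqrt_rate n.+1 + sqrt_rate n) * (sqrt_rate n.+1 - sqrt_rate n)).
  by rewrite /=; field.
rewrite vopM nr_half -!mulrA ler_pM2l ?invr_gt0 // vopM vopD.
have [/andP[r0 r1] _] := sqrt_rate_bounds n.
rewrite (le_trans (nrD _ _)) // mulrDl.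
by rewrite lerD // (le_trans (nr_sqrt_iter _ _ cc)) // ler_wpM2l // (le_trans r0).
Qed.

Lemma nr_sqrt_iter_sub c m n u : contractive c -> (m <= n)%N ->
  nr ((sqrt_iter c n - sqrt_iter c m) u) <= (sqrt_rate n - sqrt_rate m) * nr u.
Proof.
move=> cc; elim: n => [|n IH].
  by rewrite leqn0 => /eqP->; rewrite !subrr vop0 nr0 mul0r.
rewrite leq_eqVlt ltnS => /predU1P[->|mn]; first by rewrite !subrr vop0 nr0 mul0r.
have -> : sqrt_iter c n.+1 - sqrt_iter c m =
  (sqrt_iter c n.+1 - sqrt_iter c n) + (sqrt_iter c n - sqrt_iter c m).
  by rewrite addrA subrK.
rewrite vopD (le_trans (nrD _ _)) //.
rewrite (le_trans (lerD (nr_sqrt_iterS _ _ cc) (IH mn))) //.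
by rewrite -mulrDl addrA subrK.
Qed.

(** The limit satisfies [y = (c + y ^+ 2) / 2], which rearranges to [(1 - y) ^+ 2 = 1 - c]. The rate
    stays in the conclusion because automorphisms respect norm bounds, whereas no strong continuity
    is assumed of them. *)
Lemma sqrt_exists c : contractive c -> star c = c -> exists y,
  [/\ contractive y, star y = y, (1 - y) * (1 - y) = 1 - c &
    exists2 e : nat -> R, e @ \oo --> (0 : R) &
      forall n u, nr ((y - sqrt_iter c n) u) <= e n * nr u].
Proof.
move=> cc sac; pose l : R := limn sqrt_rate.
have rl : sqrt_rate @ \oo --> l by exact: is_cvg_sqrt_rate.
have le_l n : sqrt_rate n <= l.
  exact: nondecreasing_cvgn_le nondecreasing_sqrt_rate is_cvg_sqrt_rate n.
have r1 n : sqrt_rate n <= 1 by have [] := sqrt_rate_bounds n.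
have nr_le n u : nr (sqrt_iter c n u) <= 1 * nr u.
  by rewrite (le_trans (nr_sqrt_iter _ _ cc)) // ler_wpM2r ?nr_ge0.
have el : (l - sqrt_rate n @[n --> \oo]) --> (0 : R).
  by rewrite -(subrr l); apply: cvgB => //; exact: cvg_cst.
have cauchy u : exists v, conv (fun n => sqrt_iter c n u) v.
  apply: conv_complete => e e0.
  have h : ((l - sqrt_rate n) * nr u @[n --> \oo]) --> (0 : R).
    by rewrite -(mul0r (nr u)); apply: cvgM => //; exact: cvg_cst.
  move/cvgrPdist_lt: h => /(_ _ e0)[N _ hN].
  have key m n : (N <= m)%N -> (m <= n)%N ->
      nr (sqrt_iter c n u - sqrt_iter c m u) < e.
    move=> Nm mn; apply: le_lt_trans (nr_sqrt_iter_sub u cc mn) _.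
    apply: le_lt_trans (hN _ Nm); rewrite sub0r normrN.
    rewrite ger0_norm ?mulr_ge0 ?subr_ge0 ?nr_ge0 //.
    by rewrite ler_wpM2r ?nr_ge0 // lerD2r.
  exists N => m n Nm Nn; case: (leqP m n) => [mn|/ltnW nm]; last exact: key.
  by rewrite nrC key.
have [f hf] := choice cauchy.
have [y yf] := strong_limit nr_le hf.
have yconv u : conv (fun n => sqrt_iter c n u) (y u) by rewrite yf; exact: hf.
have rate n u : nr ((y - sqrt_iter c n) u) <= (l - sqrt_rate n) * nr u.
  have cv : conv (fun k => sqrt_iter c (k + n) u - sqrt_iter c n u)
                 (y u - sqrt_iter c n u).
    apply: convB; last exact: conv_cst.
    by have := yconv u; rewrite /conv -(cvg_shiftn n).
  apply: (conv_nr_le cv) => k.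
  rewrite (le_trans (nr_sqrt_iter_sub u cc (leq_addl k n))) //.
  by rewrite ler_wpM2r ?nr_ge0 // lerD2r.
have cy : contractive y.
  move=> u; apply: (conv_nr_le (yconv u)) => n.
  by rewrite -[leRHS]mul1r.
exists y; split => //.
- apply: star_eq => u v; rewrite (ripC u).
  apply: (rip_conv_eq (yconv u) (yconv v)) => n.
  by rewrite rip_star star_sqrt_iter // ripC.
- have : y = sc hM 2^-1 * (c + y * y).
    apply: vna_ext => u.
    have c1 : conv (fun n => sqrt_iter c n.+1 u) (y u).
      have := yconv u; rewrite /conv -(cvg_shiftn 1).
      by under eq_fun do rewrite addn1.
    apply: (conv_uniq c1) => /=.
    apply: (vop_conv (sc hM 2^-1)
      (s := fun n => c u + sqrt_iter c n (sqrt_iter c n u))).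
    apply: convD; first exact: conv_cst.
    (* A product of strong limits: the outer iterates are contractions, so the inner error is not
       amplified. *)
    apply: (@conv_dom _ _ (fun n =>
      nr (sqrt_iter c n u - y u) + nr (sqrt_iter c n (y u) - y (y u)))).
      by rewrite -(addr0 0); apply: cvgD; exact: yconv.
    move=> n; rewrite -(subrK (sqrt_iter c n (y u)) (sqrt_iter c n _)) -addrA.
    rewrite (le_trans (nrD _ _)) // lerD2r -vop_sub.
    by rewrite -[leRHS]mul1r.
  move=> ey; have : y + y = c + y * y.
    by rewrite {1 2}ey -mulrDl -scD (_ : 2^-1 + 2^-1 = 1 :> C) ?sc1 ?mul1r //; field.
  move/eqP; rewrite -subr_eq => /eqP <-.
  rewrite mulrBl mul1r mulrBr mulr1 !opprB opprD -addrA; congr (1 + _).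
  by rewrite addrCA.
- by exists (fun n => l - sqrt_rate n).
Qed.

End Contractions.

(** * Polar decomposition *)

Section Polar.
Context (R : realType) (H : hilbertType R) (M : set (H -> H)).
Context (hM : von_neumann_algebra M).
Local Notation A := (vna hM).
Implicit Types (a b c y z P : A) (u v w : H).

Lemma star_exp y n : star y = y -> star (y ^+ n) = y ^+ n.
Proof.
by move=> sy; elim: n => [|n IH]; rewrite ?star1 // {1}exprSr starM IH sy -exprS.
Qed.

(** For even powers, [rip ((y ^+ (m + m)) u) ((y ^+ (n + n)) u)] is the square of
    [nr ((y ^+ (m + n)) u)]. These squares decrease, which makes the sequence Cauchy. *)
Lemma power_limit y : contractive y -> star y = y ->
  exists2 P : A, star P = P & forall u, conv (fun n => (y ^+ (n + n)) u) (P u).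
Proof.
move=> cy sy.
have cyn n u : nr ((y ^+ n) u) <= nr u.
  by elim: n => [|n IH]; rewrite ?expr0 // exprS vopM (le_trans (cy _)).
pose s u n := nr ((y ^+ n) u) ^+ 2.
have s_mono u n : s u n.+1 <= s u n.
  by rewrite /s ler_sqr ?nnegrE ?nr_ge0 // exprS vopM.
have ni u : nonincreasing_seq (s u) by apply/nonincreasing_seqP => n; exact: s_mono.
have cvs u : cvgn (s u).
  apply: nonincreasing_is_cvgn => //; exists 0 => _ [n _ <-]; exact: sqr_ge0.
have ripp m n u : rip ((y ^+ (m + m)) u) ((y ^+ (n + n)) u) = s u (m + n)%N.
  have e j k : rip ((y ^+ j) u) ((y ^+ k) u) = rip u ((y ^+ (j + k)) u).
    by rewrite rip_star star_exp // -vopM -exprD.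
  by rewrite /s -ripE !e addnACA.
have cauchy u : exists v, conv (fun n => (y ^+ (n + n)) u) v.
  apply: conv_complete => e e0.
  have e20 : 0 < e ^+ 2 / 2 by rewrite divr_gt0 ?exprn_gt0.
  move/cvgrPdist_lt: (cvs u) => /(_ _ e20)[N _ hN].
  have bd n : (N <= n)%N -> limn (s u) <= s u n < limn (s u) + e ^+ 2 / 2.
    move=> Nn; have := hN n Nn => /=.
    have h := nonincreasing_cvgn_ge (ni u) (cvs u) n.
    by rewrite distrC ger0_norm ?subr_ge0 // ltrBlDl h.
  exists N => m n Nm Nn; rewrite -ltr_sqr ?nnegrE ?nr_ge0 ?(ltW e0) //.
  rewrite nrB2 ripp -!ripE !ripp.
  have := bd _ (leq_trans Nm (leq_addr m m)).
  have := bd _ (leq_trans Nn (leq_addr n n)).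
  have := bd _ (leq_trans Nm (leq_addr n m)).
  by move=> /andP[? ?] /andP[? ?] /andP[? ?]; lra.
have [f hf] := choice cauchy.
have [|P Pf] := strong_limit (s := fun n => y ^+ (n + n)) (K := 1) _ hf.
  by move=> n u; rewrite mul1r.
have Pc u : conv (fun n => (y ^+ (n + n)) u) (P u) by rewrite Pf; exact: hf.
exists P => //; apply: star_eq => u v; rewrite (ripC u).
apply: (rip_conv_eq (Pc u) (Pc v)) => n.
by rewrite rip_star star_exp // ripC.
Qed.

Lemma nr_eq a b : (forall u, nr (a u) = nr (b u)) -> star a * a = star b * b.
Proof.
move=> ab; apply/eqP; rewrite -subr_eq0; apply/eqP.
apply: sa_eq0 => [|u]; first by rewrite starB !starM !starK.
by rewrite vopB ripDl ripNl -!nr_star ab subrr.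
Qed.

(* [P] is the projection on the kernel of [1 - y], the modulus of [z], and [p]
   the partial isometry of the polar decomposition [z = p (1 - y)]. *)
Lemma polar_decomposition z y : contractive z -> contractive y -> star y = y ->
  (1 - y) * (1 - y) = star z * z ->
  exists p P : A, [/\ star P = P, star p * p = 1 - P & p * (1 - y) = z] /\
    [/\ (1 - y) * P = 0, p * P = 0 & forall a, a * (1 - y) = 0 -> a * P = a].
Proof.
move=> cz cy sy yz; have [P sP Pc] := power_limit cy sy.
have s1y : star (1 - y) = 1 - y by rewrite starB star1 sy.
have nrz u : nr (z u) = nr ((1 - y) u).
  apply/eqP; rewrite -(@eqrXn2 _ 2) ?nr_ge0 //.
  by rewrite !nr_star s1y yz.
have yyP : y * y * P = P.
  apply: vna_ext => u; apply: (conv_uniq (s := fun n => (y ^+ (n.+1 + n.+1)) u)).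
    under eq_fun do rewrite addnS addSn !exprS mulrA 2!vopM.
    rewrite 2!vopM; exact: vop_conv (vop_conv _ (Pc u)).
  have := Pc u; rewrite /conv -(cvg_shiftn 1).
  by under eq_fun do rewrite addn1.
have aP a : a * (1 - y) = 0 -> a * P = a.
  move=> /eqP; rewrite mulrBr mulr1 subr_eq0 eq_sym => /eqP ay.
  have an n : a * y ^+ n = a.
    by elim: n => [|n IH]; rewrite ?mulr1 // exprS mulrA ay.
  apply: vna_ext => u; apply: (conv_uniq (vop_conv a (Pc u))).
  by under eq_fun do rewrite -vopM an; exact: conv_cst.
(* Even powers give only [y * y * P = P], leaving room for the eigenvalue [-1]. On such a vector
   [1 - y] doubles the norm, which [nrz] and the contractivity of [z] exclude. *)
have yP : (1 - y) * P = 0.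
  have e : y * ((1 - y) * P) = - ((1 - y) * P).
    by rewrite mulrA mulrBr mulr1 mulrBl yyP mulrBl mul1r opprB.
  apply: vna_ext => u; set w := (1 - y) * P in e *; rewrite vop0.
  apply: nr_eq0; apply/eqP; rewrite eq_le nr_ge0 andbT.
  have : nr ((1 - y) (w u)) <= nr (w u) by rewrite -nrz.
  rewrite vopB -(vopM y) e vopN vop1 opprK.
  have -> : w u + w u = cR 2 *: w u.
    by rewrite -[in LHS](scale1r (w u)) -scalerDl /cR -[RHS]/(_%:C%C *: _) rmorphMn.
  by rewrite nrZ ger0_norm //; lra.
have PP : P * P = P.
  have h : P * y = P.
    by move/eqP: yP; rewrite mulrBl mul1r subr_eq0 => /eqP/(congr1 (@star _ _ _ hM));
      rewrite starM sy sP.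
  by apply: aP; rewrite mulrBr mulr1 h subrr.
(* [B n] is the sum of the first [2n] powers of [y], an approximate inverse of [1 - y]. The [B n]
   may be unbounded, but [nrzB] controls [z * B n], whose strong limit is [p]. *)
pose D := y * y; pose B := fix B n := if n is m.+1 then B m + (1 + y) * D ^+ m else 0.
have yD : (1 - y) * (1 + y) = 1 - D.
  by rewrite mulrBl mul1r mulrDr mulr1 opprD addrA addrK.
have yB n : (1 - y) * B n = 1 - D ^+ n.
  elim: n => [|n IH] /=; first by rewrite expr0 subrr mulr0.
  by rewrite mulrDr IH mulrA yD exprS mulrBl mul1r addrA subrK.
have By n : B n * (1 - y) = 1 - D ^+ n.
  rewrite -yB; suff : GRing.comm (1 - y) (B n) by move=> ->.
  have c1 : GRing.comm (1 - y) y.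
    by apply/commr_sym; apply: commrB => //; exact: commr1.
  elim: n => [|n IH] /=; first exact: commr0.
  apply: commrD => //; apply: commrM; first by apply: commrD => //; exact: commr1.
  by apply: commrX; apply: commrM.
have DE n : D ^+ n = y ^+ (n + n) by rewrite addnn -mul2n exprM expr2.
have Dc u : conv (fun n => (D ^+ n) u) (P u).
  by under eq_fun do rewrite DE; exact: Pc.
have nrzB n u : nr ((z * B n) u) = nr (u - (D ^+ n) u).
  by rewrite vopM nrz -vopM yB vopB.
have cauchy u : exists v, conv (fun n => (z * B n) u) v.
  apply: conv_complete => e e0.
  move/cvgrPdist_lt: (Dc u) => /(_ (e / 2))[|N _ hN]; first by rewrite divr_gt0.
  exists N => m n Nm Nn; rewrite !vopM -vop_sub -vopB nrz -vopM mulrBr !yB.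
  rewrite opprB addrC subrKA vopB -[(D ^+ n) u](subrK (P u)) -addrA.
  apply: le_lt_trans (nrD _ _) _; rewrite (nrC (P u)) [ltRHS](splitr e).
  have := hN n Nn; have := hN m Nm.
  by rewrite !sub0r !normrN !ger0_norm ?nr_ge0 // => ? ?; exact: ltrD.
have [f hf] := choice cauchy.
have [|p pf] := strong_limit (s := fun n => z * B n) (K := 2) _ hf.
  move=> n u; rewrite nrzB (le_trans (nrB _ _)) //.
  have : nr ((D ^+ n) u) <= nr u.
    elim: n => [|n IH]; rewrite ?expr0 // exprS vopM vopM.
    by rewrite (le_trans (cy _)) // (le_trans (cy _)).
  lra.
have pc u : conv (fun n => (z * B n) u) (p u) by rewrite pf; exact: hf.
have pp : star p * p = 1 - P.
  rewrite (@nr_eq p (1 - P)).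
    by rewrite starB star1 sP mulrBr mulr1 mulrBl mul1r PP subrr subr0.
  move=> u; rewrite -(cvg_lim _ (conv_nr (pc u))) //.
  under eq_fun do rewrite nrzB.
  apply: cvg_lim => //; apply: conv_nr; rewrite vopB; apply: convB => //.
  exact: conv_cst.
have pP : p * P = 0.
  apply: star_comp0; rewrite starM -mulrA (mulrA _ p) pp mulrBl mul1r PP.
  by rewrite subrr mulr0.
exists p, P; split; split=> //.
have zP : z * P = 0.
  apply: star_comp0; rewrite starM -mulrA (mulrA (star z)) -yz.
  by rewrite -mulrA yP !mulr0.
apply: vna_ext => u; apply: (conv_uniq (s := fun n => (z * (1 - D ^+ n)) u)).
  by under eq_fun do rewrite -By mulrA vopM; exact: pc.
have -> : z u = (z * (1 - P)) u by rewrite mulrBr mulr1 zP subr0.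
under eq_fun do rewrite vopM; rewrite vopM; apply: vop_conv.
by under eq_fun do rewrite vopB; rewrite vopB; apply: convB; [exact: conv_cst|].
Qed.

End Polar.

(** * Actions on a von Neumann algebra *)

Section AlgebraActions.
Context (R : realType) (H : hilbertType R) (M : set (H -> H)).
Context (hM : von_neumann_algebra M).
Local Notation C := (cplx R).
Local Notation A := (vna hM).

Definition central_scalars :=
  forall a : A, (forall b : A, a * b = b * a) -> exists c, a = sc hM c.

(** Only algebraic properties are recorded; norm continuity follows from them in [vact_bound]. *)
Record vn_action (G : groupType) (alpha : G -> A -> A) : Prop := VnAction {
  vactD : forall t a b, alpha t (a + b) = alpha t a + alpha t b;
  vactM : forall t a b, alpha t (a * b) = alpha t a * alpha t b;
  vact_star : forall t a, alpha t (star a) = star (alpha t a);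
  vact_sc : forall t c, alpha t (sc hM c) = sc hM c;
  vact_comp : forall s t a, alpha (s * t)%g a = alpha s (alpha t a);
  vact_one : forall a, alpha 1%g a = a }.

Definition vn_unitary (u : A) := star u * u = 1 /\ u * star u = 1.

Definition vn_outer (G : groupType) (alpha : G -> A -> A) :=
  forall t, t <> 1%g -> forall u, vn_unitary u ->
    ~ forall a, alpha t a = u * a * star u.

Definition vn_cocycle (G : groupType) (alpha : G -> A -> A) (v : G -> A) :=
  (forall g, vn_unitary (v g)) /\
  (forall g h, v (g * h)%g = v g * alpha g (v h)).

Context (G : groupType) (alpha : G -> A -> A) (act : vn_action alpha).
Implicit Types (a b c y z p : A) (u v w : H) (s t : G).

Lemma vact1 t : alpha t 1 = 1.
Proof. by rewrite -(sc1 hM) (vact_sc act). Qed.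

Lemma vactN t a : alpha t (- a) = - alpha t a.
Proof.
rewrite -[- a]mul1r mulrN -mulNr -(sc1 hM).
have -> : - sc hM 1 = sc hM (- 1).
  by apply: vna_ext => u; rewrite vopN !scE scaleNr.
rewrite (vactM act) (vact_sc act); apply: vna_ext => u.
by rewrite vopM vopN scE scaleN1r.
Qed.

Lemma vactB t a b : alpha t (a - b) = alpha t a - alpha t b.
Proof. by rewrite (vactD act) vactN. Qed.

Lemma vact0 t : alpha t 0 = 0.
Proof. by rewrite -(subrr (1 : A)) vactB !subrr. Qed.

Lemma vact_sum t (I : Type) (r : seq I) (P : pred I) (F : I -> A) :
  alpha t (\sum_(i <- r | P i) F i) = \sum_(i <- r | P i) alpha t (F i).
Proof. exact: (big_morph (alpha t) (vactD act t) (vact0 t)). Qed.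

Lemma vactK t a : alpha t (alpha t^-1%g a) = a.
Proof. by rewrite -(vact_comp act) divgg (vact_one act). Qed.

(** Since [1 - star a * a] is the square of the self-adjoint [1 - y], its image under [alpha t] is
    again such a square, hence positive. *)
Lemma vact_contractive t a : contractive a -> contractive (alpha t a).
Proof.
move=> ca; pose c := star a * a.
have sc_c : star c = c by rewrite starM starK.
have csa := contractive_star ca.
have [|y [_ sy yc _]] := sqrt_exists (c := c) _ sc_c.
  by move=> u; rewrite vopM (le_trans (csa _)).
move=> u; rewrite -ler_sqr ?nnegrE ?nr_ge0 // nr_star -(vact_star act) -(vactM act).
have -> : star a * a = 1 - (1 - y) * (1 - y) by rewrite yc subKr.
rewrite vactB vact1 (vactM act) vopB vop1 ripDl ripNl ripE gerBl.
have s1 : star (alpha t (1 - y)) = alpha t (1 - y).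
  by rewrite -(vact_star act) starB star1 sy.
by rewrite -{1}s1 -nr_star sqr_ge0.
Qed.

Lemma vact_bound t a (K : R) : 0 <= K ->
  (forall u, nr (a u) <= K * nr u) -> forall u, nr (alpha t a u) <= K * nr u.
Proof.
rewrite le_eqVlt => /predU1P[<-|K0] aK u.
  have -> : a = 0.
    apply: vna_ext => w; apply: nr_eq0; apply/eqP.
    by rewrite eq_le nr_ge0 andbT -(mul0r (nr w)) aK.
  by rewrite vact0 vop0 nr0 mul0r.
have Ki : 0 < K^-1 by rewrite invr_gt0.
have : contractive (sc hM (cR K^-1) * a).
  move=> w; rewrite vopM scE nrZ gtr0_norm //.
  by rewrite ler_pdivrMl // mulrC.
move=> /(vact_contractive t)/(_ u); rewrite (vactM act) (vact_sc act) vopM scE nrZ.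
by rewrite gtr0_norm // ler_pdivrMl // mulrC.
Qed.

(** The iterates are built from [c] and scalars, hence fixed, and the norm estimate for [y] passes
    through [alpha t] by [vact_bound]. *)
Lemma vact_sqrt_fixed t c y (e : nat -> R) : alpha t c = c ->
  e @ \oo --> (0 : R) ->
  (forall n u, nr ((y - sqrt_iter c n) u) <= e n * nr u) -> alpha t y = y.
Proof.
move=> tc e0 ye.
have tn n : alpha t (sqrt_iter c n) = sqrt_iter c n.
  elim: n => [|n IH] /=; first exact: vact0.
  by rewrite (vactM act) (vact_sc act) (vactD act) (vactM act) IH tc.
apply: vna_ext => u; apply/eqP; rewrite -subr_eq0 -vopB; apply/eqP/nr_eq0.
have c0 : (`|e n| * nr u + `|e n| * nr u @[n --> \oo]) --> (0 : R).
  have h : (`|e n| * nr u @[n --> \oo]) --> (0 : R).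
    rewrite -(mul0r (nr u)) -(normr0 R); apply: cvgM; last exact: cvg_cst.
    exact: cvg_norm.
  by rewrite -(addr0 0); apply: cvgD.
apply/eqP; rewrite eq_le nr_ge0 andbT -(cvg_lim _ c0) //.
apply: limr_ge; first by apply/cvg_ex; exists 0.
apply: nearW => n.
have -> : alpha t y - y = alpha t (y - sqrt_iter c n) - (y - sqrt_iter c n).
  by rewrite vactB tn opprB addrA subrK.
have ye' w : nr ((y - sqrt_iter c n) w) <= `|e n| * nr w.
  by rewrite (le_trans (ye n w)) // ler_wpM2r ?nr_ge0 // ler_norm.
rewrite vopB (le_trans (nrB _ _)) // lerD //.
exact: vact_bound.
Qed.

Lemma scalar_modulus y (c : C) : star y * y = sc hM c -> y != 0 ->
  exists2 k : R, 0 < k & star y * y = sc hM (cR k).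
Proof.
move=> yc y0; pose k := complex.Re (c : R[i]).
have hk u : nr (y u) ^+ 2 = k * nr u ^+ 2.
  rewrite nr_star yc scE /rip linearZl_LR /= inner_norm normE /k.
  by rewrite /cR -rmorphXn /=; case: (c) => x x' /=; ring.
have k0 : 0 < k.
  rewrite ltNge; apply: contra y0 => k0; apply/eqP/vna_ext => u.
  apply/nr_eq0/eqP; rewrite -sqrf_eq0 eq_le sqr_ge0 andbT hk.
  by rewrite mulr_le0_ge0 // sqr_ge0.
exists k => //.
have -> : sc hM (cR k) = star (sc hM (cR (Num.sqrt k))) * sc hM (cR (Num.sqrt k)).
  rewrite star_sc -scM; congr sc; rewrite geC0_conj ?(@le_cR _ 0) ?sqrtr_ge0 //.
  by rewrite -[_ * _]/((_)%:C%C * (_)%:C%C) -rmorphM -expr2 sqr_sqrtr // ltW.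
apply: nr_eq => u; rewrite scE nrZ; apply/eqP.
rewrite -(@eqrXn2 _ 2) ?nr_ge0 ?mulr_ge0 ?normr_ge0 ?nr_ge0 // hk exprMn.
by rewrite real_normK ?num_real // sqr_sqrtr // ltW.
Qed.

(** Both [star y * y] and [y * star y] are central, hence scalars, and they agree. A nonzero [y]
    would be a multiple of a unitary implementing [alpha (s * t^-1)], against outerness. *)
Lemma outer_intertwiner s t y : central_scalars -> vn_outer alpha -> s <> t ->
  (forall a, alpha s a * y = y * alpha t a) -> y = 0.
Proof.
move=> cent out st ya; apply/eqP; apply: contraT => y0.
have ya' a : star y * alpha s a = alpha t a * star y.
  have := ya (star a) => /(congr1 (@star _ _ _ hM)).
  by rewrite !starM -!(vact_star act) starK.
have [k0 yc] : exists k0 : C, star y * y = sc hM k0.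
  apply: cent => b; rewrite -(vactK t b) -mulrA -ya mulrA ya' -mulrA.
  by rewrite ?mulrA.
have [l0 yd] : exists l0 : C, star (star y) * star y = sc hM l0.
  by apply: cent => b; rewrite starK -(vactK s b) -mulrA ya' mulrA -ya mulrA.
have sy0 : star y != 0.
  by apply: contra y0 => /eqP e; rewrite -(starK y) e star0.
have {k0 yc} [k k0 yk] := scalar_modulus yc y0.
have {l0 yd} [l l0 yl] := scalar_modulus yd sy0.
rewrite starK in yl.
have [u yu] : exists u, y u != 0.
  apply: contrapT => h; move/eqP: y0; apply; apply: vna_ext => u.
  by apply: contrapT => /eqP yu; apply: h; exists u.
have kl : k = l.
  have : y * (star y * y) = y * star y * y by rewrite mulrA.
  rewrite yk yl -sc_comm => /(congr1 (fun b : A => b u)); rewrite !vopM !scE.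
  move/(congr1 (@nr R H)); rewrite !nrZ !gtr0_norm //; apply: mulIf.
  by apply: contra yu => /eqP/nr_eq0->.
pose m := sc hM (cR (Num.sqrt k)^-1).
have sm : star m = m.
  rewrite star_sc; congr sc; rewrite geC0_conj //.
  by rewrite (@le_cR _ 0) invr_ge0 sqrtr_ge0.
have mm : m * m * sc hM (cR k) = 1.
  rewrite -!scM -(sc1 hM); congr sc; rewrite -!rmorphM /= -invfM -expr2.
  by rewrite sqr_sqrtr ?ltW // mulVf ?gt_eqF.
have mC b : m * b = b * m by exact: sc_comm.
have e b z : m * b * (m * z) = m * m * (b * z).
  by rewrite -!mulrA; congr (m * _); rewrite !mulrA -(mC b).
have U1 : star (m * y) * (m * y) = 1.
  by rewrite starM sm -mC e yk.
have U2 : (m * y) * star (m * y) = 1.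
  by rewrite starM sm -(mC (star y)) e yl -kl.
have st1 : (s * t^-1)%g <> 1%g 
  by move=> st1; apply: st; rewrite -[s]mulg1 -(mulVg t) mulgA st1 mul1g.
case: (out _ st1 _ (conj U1 U2)) => a; rewrite (vact_comp act).
have := ya (alpha t^-1%g a); rewrite vactK => ya''.
rewrite -[LHS]mulr1 -U2 mulrA; congr (_ * _).
by rewrite mulrA -mC -!mulrA ya''.
Qed.

End AlgebraActions.

(** * Linear independence of outer automorphisms *)

Section Independence.
Context (R : realType) (H : hilbertType R) (M : set (H -> H)).
Context (hM : von_neumann_algebra M).
Local Notation C := (cplx R).
Local Notation A := (vna hM).
Context (T : finGroupType) (alpha : T -> A -> A) (act : vn_action alpha).
Hypotheses (cent : central_scalars hM) (out : vn_outer alpha).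
Implicit Types (a b p x : A) (u v w : H) (s t : T) (f g z : T -> H).

Lemma rip_sum (I : Type) (r : seq I) (P : pred I) (F : I -> H) u :
  rip (\sum_(i <- r | P i) F i) u = \sum_(i <- r | P i) rip (F i) u.
Proof.
by apply: (big_morph (fun v => rip v u)) => [v w|]; rewrite ?ripDl ?rip0l.
Qed.

Variable p : A.

(** Orthogonal complement, for [rips], of the families [t |-> alpha t x (p u)]. *)
Definition annihilator : set (T -> H) :=
  [set f | forall x u, \sum_t rip (alpha t x (p u)) (f t) = 0].

Lemma annihilator_subspace : real_subspace annihilator.
Proof.
split.
- by move=> x u; apply: big1 => t _; rewrite rip0r.
- move=> f g hf hg x u; under eq_bigr do rewrite ripDr.
  by rewrite big_split /= hf hg addr0.
- move=> k f hf x u; under eq_bigr do rewrite ripZr.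
  by rewrite -mulr_sumr hf mulr0.
- move=> s f hs sf x u.
  have c : (\sum_t rip (alpha t x (p u)) (s n t) @[n --> \oo]) -->
           \sum_t rip (alpha t x (p u)) (f t).
    apply: cvg_big => [|t _]; first exact: add_continuous.
    under eq_fun do rewrite ripC; rewrite ripC; exact: conv_rip.
  rewrite -(cvg_lim _ c) //; apply/cvg_lim => //.
  under eq_fun do rewrite hs; exact: cvg_cst.
Qed.

(** The annihilator is invariant under the commutant of [M] and under the diagonal operators
    [alpha t a], so the matrix entries [e r s] of the projection on it lie in [M] and intertwine
    [alpha s] with [alpha r]. Off the diagonal they vanish by outerness; on it they are scalars. *)
Lemma annihilator_eq0 : p <> 0 -> forall f, annihilator f -> f = 0.
Proof.
move=> p0.
have /choice[P hP] : forall f, exists g, annihilator g /\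
    forall z, annihilator z -> rips (f - g) z = 0.
  by move=> f; have [g] := projection_exists annihilator_subspace f; exists g.
have annP f : annihilator (P f) by have [] := hP f.
have annB f g : annihilator f -> annihilator g -> annihilator (f - g).
  have [_ hD hZ _] := annihilator_subspace.
  move=> hf hg; apply: hD => //.
  have -> : - g = cR (-1) *: g by rewrite /cR rmorphN1 scaleN1r.
  exact: hZ.
have uniqP f g : annihilator g ->
    (forall z, annihilator z -> rips (f - g) z = 0) -> P f = g.
  move=> hg fg; apply/eqP; rewrite -subr_eq0; apply/eqP/rips_eq0.
  have hz : annihilator (P f - g) by exact: annB.
  rewrite {1}(_ : P f - g = (f - g) - (f - P f)).
    by rewrite ripsDl ripsNl (hP f).2 // fg // subrr.
  by rewrite opprB [RHS]addrC subrKA.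
(* An operator preserving the annihilator together with its adjoint commutes
   with the projection [P] on it. *)
have commP (L L' : (T -> H) -> (T -> H)) :
    (forall f g, L (f - g) = L f - L g) ->
    (forall f z, rips (L f) z = rips f (L' z)) ->
    (forall f, annihilator f -> annihilator (L f)) ->
    (forall f, annihilator f -> annihilator (L' f)) ->
    forall f, P (L f) = L (P f).
  move=> LB LL' hL hL' f; apply: uniqP; first exact: hL.
  by move=> z hz; rewrite -LB LL' (hP f).2 //; exact: hL'.
have comm_diag (d d' : T -> H -> H) :
    (forall t u v, d t (u - v) = d t u - d t v) ->
    (forall t u v, rip (d t u) v = rip u (d' t v)) ->
    (forall f, annihilator f -> annihilator (fun t => d t (f t))) ->
    (forall f, annihilator f -> annihilator (fun t => d' t (f t))) ->
    forall f, P (fun t => d t (f t)) = fun t => d t (P f t).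
  move=> dB dd' hd hd' f.
  apply: (commP (fun f t => d t (f t)) (fun f t => d' t (f t))) => //.
    by move=> f1 g1; apply/funext => t; exact: dB.
  by move=> f1 z; apply: eq_bigr => t _; rewrite dd'.
have PD f g : P (f + g) = P f + P g.
  apply: uniqP => [|z hz].
    by have [_ hD _ _] := annihilator_subspace; exact: hD.
  by rewrite opprD addrACA ripsDl !(hP _).2 // addr0.
have ann_act a f : annihilator f -> annihilator (fun t => alpha t a (f t)).
  move=> hf x u; rewrite -[RHS](hf (star a * x) u); apply: eq_bigr => t _.
  by rewrite (vactM act) vopM (vact_star act) rip_starl.
have P_act a f : P (fun t => alpha t a (f t)) = fun t => alpha t a (P f t).
  apply: (comm_diag (fun t => alpha t a) (fun t => alpha t (star a)))
    => [t u v|t u v|g|g].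
  - exact: vop_sub.
  - by rewrite (vact_star act) rip_star.
  - exact: ann_act.
  - exact: ann_act.
have ann_comm y f : commutant M y -> annihilator f -> annihilator (fun t => y (f t)).
  move=> cy hf x u; rewrite -[RHS](hf x (adj y u)); apply: eq_bigr => t _.
  have cy' := commutant_adj hM cy.
  rewrite (vn_comm (vopP p) cy') (vn_comm (vopP (alpha t x)) cy').
  by rewrite ripC (adjP cy.1) ripC.
have P_comm y f : commutant M y -> P (fun t => y (f t)) = fun t => y (P f t).
  move=> cy; have [[ly _] _] := cy.
  apply: (comm_diag (fun=> y) (fun=> adj y)) => [t u v|t u v|g|g].
  - by rewrite (linD ly) (linN ly).
  - exact: adjP cy.1 _ _.
  - exact: ann_comm.
  - by apply: ann_comm; exact: commutant_adj.
pose single s u : T -> H := fun t => if t == s then u else 0.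
have rips_single s u f : rips (single s u) f = rip u (f s).
  rewrite /rips (bigD1 s) //= /single eqxx big1 ?addr0 // => t /negPf->.
  by rewrite rip0l.
have singleD s u v : single s (u + v) = single s u + single s v.
  apply/funext => t; rewrite -[RHS]/(single s u t + single s v t) /single.
  by case: eqP; rewrite ?addr0.
have single_map (d : T -> H -> H) s u : (forall t, d t 0 = 0) ->
    single s (d s u) = fun t => d t (single s u t).
  by move=> d0; apply/funext => t; rewrite /single; case: eqP => [->|_]; rewrite ?d0.
(* The annihilator is a priori a real subspace; scalars lie in the commutant, which makes the
   entries complex linear. *)
have scal_comm (c : C) : commutant M (c *: (idfun : H -> H)).
  have Mc := vn_scale hM c (vn_id hM).
  split=> [|x Mx]; first exact: (vn_bounded hM Mc).
  by apply/funext => u; rewrite /= -[LHS]/(c *: x u) -[RHS]/(x (c *: u))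
    (linZ (vn_linear hM Mx)).
have Pmap s (y : H -> H) u : commutant M y ->
    P (single s (y u)) = fun t => y (P (single s u) t).
  move=> cy; rewrite -P_comm //; congr P.
  by apply: (single_map (fun=> y)) => t; apply: lin0; case: cy => -[].
have entryM r s : M (fun u => P (single s u) r).
  apply: (vn_intro hM) => [|y cy u]; last by rewrite Pmap.
  apply/bounded_opP; split=> [c u v|].
    by rewrite singleD PD -[LHS]/(_ + _) -[c *: u]/((c *: (idfun : H -> H)) u) Pmap.
  exists 1 => // u; rewrite mul1r -ler_sqr ?nnegrE ?nr_ge0 //.
  apply: le_trans (nr_rips _ r) _; rewrite -ripE.
  have -> : rip u u = rips (single s u) (single s u).
    by rewrite rips_single /single eqxx.
  set f := single s u; have := (hP f).2 _ (annP f).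
  have := rips_ge0 (f - P f).
  by rewrite !(ripsDl, ripsNl, ripsDr, ripsNr) (ripsC f (P f)); lra.
pose e r s : A := Vna hM (entryM r s).
have eE r s a : alpha r a * e r s = e r s * alpha s a.
  apply: vna_ext => u; rewrite !vopM /vop /= -/(vop _) .
  rewrite (single_map (fun t => alpha t a)); last by move=> t; exact: lin0 (vop_lin _).
  by rewrite P_act.
have e0 r s : r <> s -> e r s = 0.
  by move=> rs; apply: (outer_intertwiner act cent out rs).
have [w pw] : exists w, nr (p w) != 0.
  apply: contrapT => h; apply: p0; apply: vna_ext => u; apply: contrapT => pu.
  by apply: h; exists u; apply/eqP => /nr_eq0.
(* Were [e s s] a nonzero scalar, the family supported at [s] with value [p w] would lie in the
   annihilator; testing it with [x = 1] and [u = w] gives [p w = 0]. *)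
have ess s : e s s = 0.
  have [c ec] : exists c : C, e s s = sc hM c.
    by apply: cent => b; rewrite -(vactK act s b) eE.
  have [c0|c0] := eqVneq c 0.
    by rewrite ec c0; apply: vna_ext => u; rewrite scE scale0r.
  have Pe r : P (single s (c^-1 *: p w)) r = e r s (c^-1 *: p w) by [].
  have := annP (single s (c^-1 *: p w)) 1 w.
  rewrite (bigD1 s) //= big1 => [|t /eqP ts]; last by rewrite Pe e0 // vop0 rip0r.
  rewrite addr0 Pe ec scE scalerA divff // scale1r (vact1 act) vop1 ripE.
  move=> /eqP; rewrite sqrf_eq0 => /eqP/nr_eq0 pw0.
  by rewrite pw0 nr0 eqxx in pw.
move=> f hf; apply/funext => s; apply: nr_eq0; apply/eqP; rewrite -sqrf_eq0 -ripE.
have P0 : P (single s (f s)) = 0.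
  apply/funext => r; have [->|/eqP rs] := eqVneq r s.
    by have := ess s => /(congr1 (fun b : A => b (f s))); rewrite vop0.
  by have := e0 _ _ rs => /(congr1 (fun b : A => b (f s))); rewrite vop0.
by rewrite -(rips_single s (f s)) -[single _ _]subr0 -P0 (hP _).2.
Qed.

End Independence.

(** For each [v] the family [t |-> star (b t) v] lies in the annihilator. *)
Lemma outer_independent (R : realType) (H : hilbertType R) (M : set (H -> H))
    (hM : von_neumann_algebra M) (T : finGroupType)
    (alpha : T -> vna hM -> vna hM) (b : T -> vna hM) (p : vna hM) :
  vn_action alpha -> central_scalars hM -> vn_outer alpha -> p <> 0 ->
  (forall x, \sum_t b t * alpha t x * p = 0) -> forall t, b t = 0.
Proof.
move=> act cent out p0 hb t; rewrite -[b t]starK -[RHS]star0; congr star.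
apply: vna_ext => v; rewrite vop0.
suff /(congr1 (@^~ t)) : (fun s => star (b s) v) = 0 by [].
apply: (annihilator_eq0 act cent out p0) => x u.
have /(congr1 (fun a : vna hM => rip (a u) v)) := hb x.
rewrite vop_sum rip_sum vop0 rip0l => e; rewrite -[RHS]e.
by apply: eq_bigr => s _; rewrite !vopM -rip_star.
Qed.

(** * Partial isometries and the trace *)

(** [next] realizes at least half of the gain in [f] still possible. Along the iterates [f]
    converges, so the possible gain tends to zero, and an upper bound of the sequence is maximal for
    [f]. *)
Lemma greedy_maximal (R : realType) (X : Type) (le : X -> X -> Prop) (f : X -> R)
    (K : R) (x0 : X) :
  (forall x, le x x) -> (forall x y z, le x y -> le y z -> le x z) ->
  (forall x y, le x y -> f x <= f y) -> (forall x, f x <= K) ->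
  (forall s : nat -> X, (forall n, le (s n) (s n.+1)) ->
     exists u, forall n, le (s n) u) ->
  exists m, forall y, le m y -> f y <= f m.
Proof.
move=> le_refl le_trans fm fK ub.
have /choice[next hn] : forall x, exists x', le x x' /\
    forall y, le x y -> f y <= 2 * f x' - f x.
  move=> x; pose S := [set f y | y in le x].
  have hS : has_sup S.
    split; first by exists (f x), x.
    by exists K => _ [y _ <-].
  have le_sup y : le x y -> f y <= sup S.
    by move=> xy; apply: (ub_le_sup hS.2); exists y.
  have [e|ne] := eqVneq (sup S) (f x).
    by exists x; split=> // y /le_sup; rewrite e; lra.
  have d0 : 0 < (sup S - f x) / 2.
    by rewrite divr_gt0 // subr_gt0 lt_def ne le_sup.
  have [_ [x' xx' <-] hx'] := sup_adherent d0 hS.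
  by exists x'; split=> // y /le_sup; lra.
pose s n := iter n next x0.
have sS n : le (s n) (s n.+1) by have [] := hn (s n).
have [u hu] := ub s sS; exists u => y uy.
have ni : nondecreasing_seq (f \o s).
  by apply/nondecreasing_seqP => n; exact: fm.
have cv : cvgn (f \o s).
  by apply: nondecreasing_is_cvgn => //; exists K => _ [n _ <-]; exact: fK.
have cv1 : ((f \o s) n.+1 @[n --> \oo]) --> limn (f \o s).
  have : ((f \o s) n @[n --> \oo]) --> limn (f \o s) by exact: cv.
  by rewrite -(cvg_shiftn 1); under eq_fun do rewrite addn1.
have cv2 : (2 * f (s n.+1) - f (s n) @[n --> \oo]) -->
    2 * limn (f \o s) - limn (f \o s).
  by apply: cvgB cv; apply: cvgM cv1; exact: cvg_cst.
have h1 : f y <= 2 * limn (f \o s) - limn (f \o s).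
  rewrite -(cvg_lim _ cv2) //; apply: limr_ge.
    by apply/cvg_ex; eexists; exact: cv2.
  by apply: nearW => n; apply: (hn (s n)).2; exact: le_trans (hu n) uy.
have h2 : limn (f \o s) <= f u.
  by apply: limr_le => //; apply: nearW => n; exact: fm.
by lra.
Qed.

Section CocycleVanishing.
Context (R : realType) (H : hilbertType R) (M : set (H -> H)).
Context (hM : von_neumann_algebra M).
Local Notation C := (cplx R).
Local Notation A := (vna hM).
Implicit Types (a b c p q u z y : A) (w : H).

Record faithful_trace (tau : A -> R) : Prop := FaithfulTrace {
  traceD : forall a b, tau (a + b) = tau a + tau b;
  traceC : forall a b, tau (a * b) = tau (b * a);
  trace_ge0 : forall a, 0 <= tau (star a * a);
  trace_eq0 : forall a, tau (star a * a) = 0 -> a = 0 }.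

(** Allows [sqrt_exists] with [c = 1 - star a * a], for which [1 - y] is the modulus of [a]. *)
Lemma contractive_1B a : contractive a -> contractive (1 - star a * a).
Proof.
move=> ca u; rewrite -ler_sqr ?nnegrE ?nr_ge0 // vopB vop1 nrB2.
have : rip u ((star a * a) u) = nr (a u) ^+ 2 by rewrite nr_star ripC.
have : nr ((star a * a) u) <= nr (a u) by rewrite vopM; exact: contractive_star.
move=> h0 ->; have : nr ((star a * a) u) ^+ 2 <= nr (a u) ^+ 2.
  by rewrite ler_sqr ?nnegrE ?nr_ge0.
by have := sqr_ge0 (nr (a u)); lra.
Qed.

Lemma comp_star0 a : a * star a = 0 -> a = 0.
Proof. by rewrite -{1}[a]starK => /star_comp0 e; rewrite -[a]starK e star0. Qed.

Definition partial_isometry u := u * (star u * u) = u.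

(** [star u * u] projects on the initial space of [u], where [u'] has to agree with [u]. *)
Definition extends u u' := u' * (star u * u) = u.

Lemma initial_idem u : partial_isometry u ->
  star u * u * (star u * u) = star u * u.
Proof. by move=> hu; rewrite -[LHS]mulrA hu. Qed.

Lemma star_initial u : star (star u * u) = star u * u.
Proof. by rewrite starM starK. Qed.

Lemma initial_star u : partial_isometry u -> star u * u * star u = star u.
Proof. by move=> /(congr1 (@star _ _ _ hM)); rewrite starM star_initial. Qed.

Lemma extends_compress u u' : extends u u' ->
  star u * u * (star u' * u') * (star u * u) = star u * u.
Proof.
rewrite /extends; set e := star u * u => uu'.
by rewrite -[RHS]/(star u * u) -uu' starM star_initial !mulrA.
Qed.

(** The hypotheses make [star (b * a - a) * (b * a - a)] vanish. *)
Lemma sub_projection a b : star a = a -> star b = b -> a * a = a -> b * b = b ->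
  a * b * a = a -> b * a = a.
Proof.
move=> sa sb aa bb aba; apply/eqP; rewrite -subr_eq0; apply/eqP/star_comp0.
by rewrite starB starM sa sb mulrBr !mulrBl -!mulrA (mulrA b b) bb !mulrA aba aa
  !subrr.
Qed.

Lemma extends_initial u u' : partial_isometry u -> partial_isometry u' ->
  extends u u' -> star u' * u' * (star u * u) = star u * u.
Proof.
move=> hu hu' uu'; apply: sub_projection; rewrite ?star_initial ?initial_idem //.
exact: extends_compress.
Qed.

Lemma extends_trans u u' u'' : partial_isometry u -> partial_isometry u' ->
  extends u u' -> extends u' u'' -> extends u u''.
Proof.
move=> hu hu' uu' uu''; rewrite /extends -(extends_initial hu hu' uu').
by rewrite mulrA uu''.
Qed.

Variable tau : A -> R.
Hypothesis tauP : faithful_trace tau.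

Lemma traceB a b : tau (a - b) = tau a - tau b.
Proof. by have := traceD tauP (a - b) b; rewrite subrK => e; lra. Qed.

(** Positivity of the trace on [star x * x] for [x = u' * (1 - star u * u)]; every term of the
    expansion other than [star u' * u'] has trace plus or minus [tau (star u * u)]. *)
Lemma extends_trace u u' : partial_isometry u -> extends u u' ->
  tau (star u * u) <= tau (star u' * u').
Proof.
move=> hu uu'; set e := star u * u; set e' := star u' * u'.
have ee : e * e = e by exact: initial_idem.
have ee'e : e * e' * e = e by exact: extends_compress.
have h := trace_ge0 tauP (u' * (1 - e)).
have E : star (u' * (1 - e)) * (u' * (1 - e)) = (1 - e) * e' * (1 - e).
  by rewrite starM starB star1 star_initial !mulrA.
have t1 : tau (e' * e) = tau e by rewrite -[in LHS]ee mulrA (traceC tauP) mulrA ee'e.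
have t2 : tau (e * e') = tau e by rewrite (traceC tauP).
move: h; rewrite E mulrBl mul1r mulrBr mulr1 mulrBl ee'e !traceB t1 t2.
by lra.
Qed.

Lemma partial_isometry_contractive u : partial_isometry u -> contractive u.
Proof.
move=> hu w; rewrite -ler_sqr ?nnegrE ?nr_ge0 //.
have e : nr ((1 - star u * u) w) ^+ 2 = nr w ^+ 2 - nr (u w) ^+ 2.
  rewrite nr_star starB star1 star_initial mulrBr mulr1 mulrBl mul1r.
  by rewrite initial_idem // subrr subr0 vopB ripDl ripNl -nr_star ripE.
by have := sqr_ge0 (nr ((1 - star u * u) w)); rewrite e subr_ge0.
Qed.

(** Pythagoras gives [nr (s n w - s m w) ^+ 2 = a w n - a w m], hence a strong limit. The last
    clause says that the initial space of [u] is no larger than what those of the [s n] span; being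
    algebraic, it serves where [alpha t] cannot be moved through the limit. *)
Lemma extends_limit (s : nat -> A) : (forall n, partial_isometry (s n)) ->
  (forall n, extends (s n) (s n.+1)) ->
  exists u, [/\ partial_isometry u, forall n, extends (s n) u &
    forall a, (forall n, a * (star (s n) * s n) = 0) -> a * star u = 0].
Proof.
move=> ps sS; pose e n := star (s n) * s n.
have mn m n : (m <= n)%N -> extends (s m) (s n).
  elim: n => [|n IH]; first by rewrite leqn0 => /eqP->; exact: ps.
  rewrite leq_eqVlt ltnS => /predU1P[->|/IH]; first exact: ps.
  by move=> h; apply: extends_trans (sS n).
pose a w n := nr (s n w) ^+ 2.
have diff m n w : (m <= n)%N -> nr (s n w - s m w) ^+ 2 = a w n - a w m.
  move=> /mn h; have se := extends_initial (ps m) (ps n) h.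
  have es : e m * e n = e m.
    by rewrite -{1}[e m]star_initial -[e n]star_initial -starM se star_initial.
  rewrite -vopB nr_star; have -> : s n - s m = s n * (1 - e m).
    by rewrite mulrBr mulr1 h.
  rewrite starM starB star1 star_initial -mulrA (mulrA _ (s n)) -/(e n) mulrBr mulr1.
  rewrite [e n * e m]se -/(e m) mulrBl mul1r mulrBr es initial_idem // subrr subr0.
  by rewrite vopB ripDl ripNl /a !nr_star.
have ni w : nondecreasing_seq (a w).
  apply/nondecreasing_seqP => n; rewrite -subr_ge0 -diff ?leqnSn //.
  exact: sqr_ge0.
have ca w : cvgn (a w).
  apply: nondecreasing_is_cvgn => //; exists (nr w ^+ 2) => _ [n _ <-].
  rewrite /a ler_sqr ?nnegrE ?nr_ge0 //; exact: partial_isometry_contractive.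
have cauchy w : exists v, conv (fun n => s n w) v.
  apply: conv_complete => d d0.
  have d2 : 0 < d ^+ 2 by rewrite exprn_gt0.
  move/cvgrPdist_lt: (ca w) => /(_ _ d2)[N _ hN].
  have key m n : (N <= m)%N -> (m <= n)%N -> nr (s n w - s m w) < d.
    move=> Nm lmn; rewrite -ltr_sqr ?nnegrE ?nr_ge0 ?(ltW d0) // diff //.
    have := hN m Nm; have h1 := nondecreasing_cvgn_le (ni w) (ca w) m.
    have h2 := nondecreasing_cvgn_le (ni w) (ca w) n.
    by rewrite ger0_norm ?subr_ge0 //; lra.
  exists N => m n Nm Nn; case: (leqP m n) => [h|/ltnW h]; last exact: key.
  by rewrite nrC key.
have [f hf] := choice cauchy.
have [|u uf] := strong_limit (s := s) (K := 1) _ hf.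
  by move=> n w; rewrite mul1r; exact: partial_isometry_contractive.
have uc w : conv (fun n => s n w) (u w) by rewrite uf; exact: hf.
have tail m (g : nat -> H) l : (forall n, (m <= n)%N -> g n = l) -> conv g l.
  move=> gl; rewrite /conv -(cvg_shiftn m).
  under eq_fun do rewrite gl ?leq_addl //.
  exact: conv_cst.
have ue n : extends (s n) u.
  apply: vna_ext => w; apply: (conv_uniq (s := fun k => (s k * e n) w)).
    by under eq_fun do rewrite vopM; rewrite vopM; exact: uc.
  by apply: (tail n) => k nk; rewrite (mn n k nk).
(* The adjoint is taken because [s n], rather than [star (s n)], is known to converge strongly. *)
have kill b : (forall n, b * e n = 0) -> b * star u = 0.
  move=> be; have h n : s n * star b = 0.
    rewrite -[s n]ps -mulrA -[star _ * _]star_initial -/(e n) -starM.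
    by rewrite -/(e n) be star0 mulr0.
  rewrite -[b]starK -starM -star0; congr star; apply: vna_ext => w.
  rewrite vopM; apply: (conv_uniq (uc _)).
  by under eq_fun do rewrite -vopM h; exact: conv_cst.
exists u; split=> //; rewrite /partial_isometry; set E := star u * u.
have su n : star (s n) * u = e n.
  apply: vna_ext => w; rewrite vopM.
  apply: (conv_uniq (vop_conv (star (s n)) (uc w))).
  apply: (tail n) => k nk; rewrite -vopM.
  have se := extends_initial (ps n) (ps k) (mn n k nk).
  rewrite -[in star (s n)](mn n k nk) starM star_initial -mulrA -/(e n) -/(e k).
  by rewrite -{1}[e n]star_initial -[e k]star_initial -starM se star_initial.
have Ee n : E * e n = e n.
  by rewrite /E -mulrA ue -[RHS]star_initial -/(e n) -su starM starK.
(* The defect [u * E - u] vanishes on all the initial spaces, hence on the range of [star u]; its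
   product with its own adjoint is then zero. *)
have du : (u * E - u) * star u = 0.
  by apply: kill => n; rewrite mulrBl -mulrA Ee subrr.
apply/eqP; rewrite -subr_eq0; apply/eqP/comp_star0.
have -> : star (u * E - u) = E * star u - star u.
  by rewrite starB starM star_initial.
have Es : E * star u = star u * (u * star u) by rewrite /E mulrA.
by rewrite mulrBr du subr0 Es (mulrA (u * E - u)) du mul0r.
Qed.

End CocycleVanishing.

(** * Vanishing of the cohomology of finite groups *)

Section Coboundary.
Context (R : realType) (H : hilbertType R) (M : set (H -> H)).
Context (hM : von_neumann_algebra M).
Local Notation C := (cplx R).
Local Notation A := (vna hM).
Context (T : finGroupType) (alpha : T -> A -> A) (act : vn_action alpha).
Implicit Types (a b c p q u z y : A) (s t : T).

(** Applying [alpha t] to the hypothesis for [t^-1] reverses the inequality between [p] and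
    [alpha t p]. *)
Lemma fixed_of_le p : star p = p -> p * p = p ->
  (forall t, alpha t p * p = p) -> forall t, alpha t p = p.
Proof.
move=> sp pp ap t.
have : alpha t (alpha t^-1%g p * p) = alpha t p by rewrite ap.
rewrite (vactM act) (vactK act) => <-.
rewrite -[LHS]starK starM -(vact_star act) !sp.
by rewrite ap sp.
Qed.

Lemma fixed_of_ge p : star p = p -> p * p = p ->
  (forall t, alpha t p * p = alpha t p) -> forall t, alpha t p = p.
Proof.
move=> sp pp ap t.
have /(congr1 (alpha t)) := ap t^-1%g.
rewrite (vactM act) (vactK act) => h.
rewrite -[RHS]h -[RHS]starK starM -(vact_star act) !sp ap.
by rewrite -(vact_star act) sp.
Qed.

Variables (v : T -> A) (vP : vn_cocycle alpha v).

Definition twisted_fixed z := forall t, v t * alpha t z = z.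

Lemma twisted_initial u : twisted_fixed u ->
  forall t, alpha t (star u * u) = star u * u.
Proof.
move=> hu t; rewrite (vactM act) (vact_star act) -[in RHS](hu t) starM.
by rewrite -mulrA [star (v t) * _]mulrA (proj1 (vP.1 t)) mul1r.
Qed.

Lemma twisted_final u t : twisted_fixed u ->
  v t * alpha t (1 - u * star u) = (1 - u * star u) * v t.
Proof.
move=> hu; rewrite (vactB act) (vact1 act) (vactM act) (vact_star act).
rewrite mulrBr mulr1 mulrBl mul1r mulrA hu; congr (_ - _).
have -> : star (alpha t u) = star u * v t.
  by rewrite -[in RHS](hu t) starM -mulrA (proj1 (vP.1 t)) mulr1.
by rewrite mulrA.
Qed.

(** By the cocycle identity, [v t * alpha t] sends the term of index [s] to that of index
    [t * s]. *)
Lemma twisted_sum a t :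
  v t * alpha t (\sum_s v s * alpha s a) = \sum_s v s * alpha s a.
Proof.
rewrite (vact_sum act) mulr_sumr [RHS](reindex_inj (mulgI t)) /=.
apply: eq_bigr => s _.
by rewrite (vactM act) (vact_comp act) mulrA -(vP.2 t s).
Qed.

(** The defect [v t * alpha t u - u] vanishes on the initial projections of all the [s n], because
    these projections are fixed; the last hypothesis carries this over to the initial projection of
    [u]. *)
Lemma twisted_limit (s : nat -> A) u : (forall n, twisted_fixed (s n)) ->
  partial_isometry u -> (forall n, extends (s n) u) ->
  (forall a, (forall n, a * (star (s n) * s n) = 0) -> a * star u = 0) ->
  twisted_fixed u.
Proof.
move=> hs hu su kill.
have E1 t : v t * alpha t u * (star u * u) = u.
  have : (v t * alpha t u - u) * star u = 0.
    apply: kill => n; rewrite mulrBl su -{1}(twisted_initial (hs n) t) -mulrA.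
    by rewrite -(vactM act) su hs subrr.
  move=> /(congr1 (fun b => b * u)); rewrite mul0r mulrBl mulrBl -!mulrA hu.
  by rewrite mulrA => /eqP; rewrite subr_eq0 => /eqP; rewrite !mulrA.
(* Multiplying each side of [E1] by its adjoint on the left bounds [star u * u] by its image under
   [alpha t]; this holds for every [t], hence equality. *)
have fixE : forall t, alpha t (star u * u) = star u * u.
  apply: fixed_of_le => [||t]; rewrite ?star_initial ?initial_idem //.
  apply: sub_projection; rewrite ?star_initial ?initial_idem //.
  - by rewrite -(vact_star act) star_initial.
  - by rewrite -(vactM act) initial_idem.
  - rewrite -[RHS]/(star u * u) -[in RHS](E1 t) (vactM act) (vact_star act).
    rewrite !starM starK -!mulrA; congr (star u * (u * _)).
    by rewrite [star (v t) * _]mulrA (proj1 (vP.1 t)) mul1r.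
move=> t; rewrite -[RHS](E1 t) -(fixE t) -mulrA -(vactM act).
by rewrite hu.
Qed.

Hypotheses (cent : central_scalars hM) (out : vn_outer alpha).

Lemma twisted_exists u : twisted_fixed u -> partial_isometry u ->
  1 - star u * u <> 0 -> 1 - u * star u <> 0 ->
  exists z, [/\ twisted_fixed z, contractive z, z <> 0,
                (1 - u * star u) * z = z & z * (star u * u) = 0].
Proof.
set e := star u * u; set q := 1 - u * star u => hu pu p0 q0.
have fe t : alpha t e = e by exact: twisted_initial.
have ee : e * e = e by exact: initial_idem.
have sq : star q = q by rewrite starB star1 starM starK.
have qu : q * u = 0 by rewrite mulrBl mul1r -mulrA pu subrr.
have qq : q * q = q by rewrite {2}/q mulrBr mulr1 mulrA qu mul0r subr0.
(* Otherwise independence gives [q * v t = 0] for all [t], and [t = 1] yields [q = 0]. *)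
have [x zx] : exists x, \sum_t q * v t * alpha t x * (1 - e) <> 0.
  apply: contrapT => h; apply: q0.
  have := outer_independent (b := fun t => q * v t) act cent out p0.
  move=> /(_ (fun x => contrapT (fun hx => h (ex_intro _ x hx))))/(_ 1%g).
  move=> /(congr1 (fun b => b * star (v 1%g))).
  by rewrite -mulrA (proj2 (vP.1 1%g)) mulr1 mul0r.
pose z0 := \sum_t q * v t * alpha t x * (1 - e).
(* In this form [z0] is seen to be twisted fixed: [1 - e] is fixed, and [q] moves across by
   [twisted_final]. *)
have z0E : z0 = q * (\sum_t v t * alpha t x) * (1 - e).
  by rewrite mulr_sumr mulr_suml; apply: eq_bigr => t _; rewrite !mulrA.
have tz0 : twisted_fixed z0.
  move=> t; rewrite z0E (vactM act) (vactB act) (vact1 act) fe (vactM act) !mulrA.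
  by rewrite twisted_final // -/q -[q * v t * _]mulrA twisted_sum.
have [K K0 zK] := vop_bound z0.
(* Rescaling makes [z0] contractive, as the polar decomposition requires; [K] may be zero, hence
   [K + 1]. *)
have k0 : 0 < (K + 1)^-1 by rewrite invr_gt0; lra.
pose m := sc hM (cR (K + 1)^-1).
exists (m * z0); split.
- by move=> t; rewrite (vactM act) (vact_sc act) mulrA -sc_comm -mulrA tz0.
- move=> w; rewrite vopM scE nrZ gtr0_norm // ler_pdivrMl; last by lra.
  by rewrite (le_trans (zK w)) // ler_wpM2r ?nr_ge0 //; lra.
- move=> /(congr1 (fun b => sc hM (cR (K + 1)) * b)); rewrite mulr0 mulrA -scM.
  rewrite (_ : cR (K + 1) * _ = 1) ?sc1 ?mul1r //.
  by rewrite /cR -rmorphM mulfV //; apply/eqP; lra.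
- by rewrite mulrA -sc_comm -mulrA; congr (_ * _); rewrite z0E !mulrA qq.
- have pe : (1 - e) * e = 0 by rewrite mulrBl mul1r ee subrr.
  by rewrite -mulrA z0E -(mulrA _ (1 - e)) pe !mulr0.
Qed.

(** An element [a] vanishes once [a * (1 - y) = 0] and [a * P = 0], since the first gives
    [a * P = a]. For the defect of a left identity of [w], the first condition is that identity for
    [z], and the second follows from [w * P = 0], with [P] fixed by the action. *)
Lemma twisted_polar z : twisted_fixed z -> contractive z -> z <> 0 ->
  exists w : A, [/\ twisted_fixed w, partial_isometry w, w <> 0,
    forall q, q * z = z -> q * w = w &
    forall e, star e = e -> z * e = 0 -> w * e = 0].
Proof.
move=> hz cz z0; pose c := 1 - star z * z.
have sac : star c = c by rewrite starB star1 star_initial.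
have fc t : alpha t c = c.
  by rewrite (vactB act) (vact1 act) twisted_initial.
have [y [cy sy yy [err err0 yerr]]] := sqrt_exists (contractive_1B cz) sac.
have fy t : alpha t y = y by exact: vact_sqrt_fixed err0 yerr.
have yz : (1 - y) * (1 - y) = star z * z by rewrite yy subKr.
have s1y : star (1 - y) = 1 - y by rewrite starB star1 sy.
have [w [P [[sP ww wz] [yP wP aP]]]] := polar_decomposition cz cy sy yz.
have PP : P * P = P.
  apply: aP; rewrite -sP -s1y -starM -star0; congr star.
  exact: yP.
have fP : forall t, alpha t P = P.
  apply: fixed_of_ge => // t; apply: aP.
  rewrite -sP -s1y (vact_star act) -starM -star0; congr star.
  by rewrite -(fy t) -(vact1 act t) -(vactB act) -(vactM act) yP (vact0 act).
exists w; split.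
- move=> t; apply/eqP; rewrite -subr_eq0; apply/eqP.
  rewrite -[LHS]aP; first by rewrite mulrBl wP subr0 -{1}(fP t) -mulrA -(vactM act)
    wP (vact0 act) mulr0.
  rewrite mulrBl wz -{1}(fy t) -(vact1 act t) -(vactB act) -mulrA -(vactM act).
  by rewrite wz hz subrr.
- by rewrite /partial_isometry ww mulrBr mulr1 wP subr0.
- by move=> w0; apply: z0; rewrite -wz w0 mul0r.
- move=> q qz; apply/eqP; rewrite -subr_eq0; apply/eqP.
  rewrite -[LHS]aP; first by rewrite mulrBl -mulrA wP mulr0 subrr.
  by rewrite mulrBl -mulrA wz qz subrr.
- move=> e se ze; have ye : (1 - y) * e = 0.
    apply: star_comp0; rewrite starM s1y se -!mulrA (mulrA (1 - y)) yz.
    by rewrite -!mulrA ze !mulr0.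
  have Pe : P * e = e.
    rewrite -[LHS]starK starM sP se aP ?se //.
    by rewrite -[LHS]starK starM s1y se ye star0.
  by rewrite -Pe mulrA wP mul0r.
Qed.

Variable tau : A -> R.
Hypothesis tauP : faithful_trace tau.

(** Maximality of the trace of the initial projection is enough: adding a nonzero [w] with
    orthogonal initial and final spaces raises it by [tau (star w * w)]. *)
Theorem cocycle_coboundary : exists u, vn_unitary u /\ twisted_fixed u.
Proof.
pose X := {u : A | twisted_fixed u /\ partial_isometry u}.
pose f (x : X) := tau (star (sval x) * sval x).
have x0P : twisted_fixed 0 /\ partial_isometry (0 : A).
  by split=> [t|]; rewrite /partial_isometry ?(vact0 act) ?mulr0 ?mul0r.
have [] := @greedy_maximal R X (fun x x' : X => extends (sval x) (sval x')) f (tau 1)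
  (exist _ _ x0P).
- by move=> [x [hx px]]; exact: px.
- by move=> [x [? ?]] [y [? ?]] [z [? ?]]; exact: extends_trans.
- by move=> [x [? ?]] [y [? ?]]; exact: extends_trace.
- move=> [x [hx px]]; rewrite /f /= -subr_ge0 -(traceB tauP).
  have := trace_ge0 tauP (1 - star x * x).
  rewrite starB star1 star_initial mulrBr mulr1 mulrBl mul1r.
  by rewrite initial_idem // subrr subr0.
- move=> s hs; have [|u [pu su kill]] := extends_limit _ hs.
    by move=> n; case: (svalP (s n)).
  have hu : twisted_fixed u.
    by apply: (twisted_limit _ pu su kill) => n; case: (svalP (s n)).
  by have h := conj hu pu; exists (exist _ _ h : X).
move=> [u [hu pu]] max_u.
have : 1 - star u * u = 0 \/ 1 - u * star u = 0.
  apply: contrapT => /not_orP[p0 q0].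
  have [z [hz cz z0 qz ze]] := twisted_exists hu pu p0 q0.
  have [w [hw pw w0 qw we]] := twisted_polar hz cz z0.
  have {qw}qw := qw _ qz; have {we}we := we _ (star_initial u) ze.
  have wu : w * star u = 0 by rewrite -(initial_star pu) mulrA we mul0r.
  have uw : star u * w = 0.
    by rewrite -qw mulrA mulrBr mulr1 mulrA initial_star // subrr mul0r.
  have uw' : u * star w = 0 by rewrite -[LHS]starK starM starK wu star0.
  have wu' : star w * u = 0 by rewrite -[LHS]starK starM starK uw star0.
  have ini : star (u + w) * (u + w) = star u * u + star w * w.
    by rewrite starD mulrDl !mulrDr uw wu' addr0 add0r.
  have h' : twisted_fixed (u + w) /\ partial_isometry (u + w).
    split=> [t|]; first by rewrite (vactD act) mulrDr hu hw.
    rewrite /partial_isometry ini mulrDl !mulrDr pu pw we add0r.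
    by rewrite mulrA uw' mul0r addr0.
  have ext : extends u (u + w) by rewrite /extends mulrDl pu we addr0.
  have := max_u (exist _ _ h') ext; rewrite /f /= ini (traceD tauP) gerDl.
  move=> tw; apply: w0; apply: (trace_eq0 tauP).
  by apply: le_anti; rewrite tw (trace_ge0 tauP).
(* Finiteness: for an isometry [a] the projection [1 - a * star a] has trace zero. *)
have key a : a * (star a * a) = a -> star a * a = 1 -> a * star a = 1.
  move=> pa aa; have pp : star (1 - a * star a) * (1 - a * star a) = 1 - a * star a.
    rewrite starB star1 starM starK mulrBr mulr1 mulrBl mul1r.
    by rewrite -!mulrA (mulrA (star a)) aa mul1r subrr subr0.
  have : 1 - a * star a = 0.
    apply: (trace_eq0 tauP).
    by rewrite pp (traceB tauP) -aa (traceC tauP a) aa subrr.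
  by move/eqP; rewrite subr_eq0 => /eqP.
case=> /eqP; rewrite subr_eq0 eq_sym => /eqP e1; exists u; split=> //; split=> //.
- exact: key.
- by have := key (star u); rewrite starK; apply=> //; rewrite e1 mulr1.
Qed.

End Coboundary.

(** * Amalgamated free products *)

Section Bijections.
Context (X : Type).

(** Symmetric group of [X], a test group for the universal property. *)
Record bijection := Bijection {
  bfun :> X -> X; binv : X -> X; bfunK : cancel bfun binv; binvK : cancel binv bfun }.

HB.instance Definition _ := gen_eqMixin bijection.
HB.instance Definition _ := gen_choiceMixin bijection.

Lemma bijection_ext (f g : bijection) : f =1 g -> f = g.
Proof.
case: f g => [f f' fK f'K] [g g' gK g'K] /= /funext e; case: g / e gK g'K => gK g'K.
have e : f' = g' by apply/funext => x; rewrite -{1}(g'K x) fK.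
case: g' / e gK g'K => gK g'K.
by rewrite (Prop_irrelevance fK gK) (Prop_irrelevance f'K g'K).
Qed.

Let one := @Bijection id id (fun=> erefl) (fun=> erefl).
Let inv (f : bijection) := Bijection (@binvK f) (@bfunK f).
Let mul (f g : bijection) :=
  Bijection (can_comp (@bfunK f) (@bfunK g)) (can_comp (@binvK g) (@binvK f)).

Let mulA : associative mul. Proof. by move=> f g h; exact: bijection_ext. Qed.
Let mul1 : left_id one mul. Proof. by move=> f; exact: bijection_ext. Qed.
Let mulx1 : right_id one mul. Proof. by move=> f; exact: bijection_ext. Qed.
Let mulV : left_inverse one inv mul.
Proof. by move=> f; apply: bijection_ext => x; exact: bfunK. Qed.
Let mulxV : right_inverse one inv mul.
Proof. by move=> f; apply: bijection_ext => x; exact: binvK. Qed.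

HB.instance Definition _ := isGroup.Build bijection mulA mul1 mulx1 mulV mulxV.

Lemma bfunM (f g : bijection) x : (f * g)%g x = f (g x). Proof. by []. Qed.

End Bijections.

Definition multiplicative_of (G K : groupType) (f : G -> K)
    (fM : {morph f : x y / (x * y)%g}) : {multiplicative G -> K} :=
  HB.pack f (isMultiplicative.Build G K f fM).

Section GroupMorphisms.
Context (G K : groupType) (f : {multiplicative G -> K}).

Lemma mult1 : f 1%g = 1%g.
Proof. by apply: (mulgI (f 1%g)); rewrite -gmulfM !mulg1. Qed.

Lemma multV x : f x^-1%g = (f x)^-1%g.
Proof. by apply: (mulgI (f x)); rewrite -gmulfM !mulgV mult1. Qed.

End GroupMorphisms.

Section LeftMultiplication.
Context (G : groupType) (X : Type).

Let shift (g : G) (x : G * X) : G * X := ((g * x.1)%g, x.2).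

Let shiftK g : cancel (shift g) (shift g^-1%g).
Proof. by move=> [a b]; rewrite /shift /= mulKg. Qed.

Let shiftVK g : cancel (shift g^-1%g) (shift g).
Proof. by move=> [a b]; rewrite /shift /= mulVKg. Qed.

Definition left_mult (g : G) : bijection (G * X) :=
  Bijection (shiftK g) (shiftVK g).

Lemma left_multM : {morph left_mult : g h / (g * h)%g}.
Proof. by move=> g h; apply: bijection_ext => x; rewrite /= /shift /= mulgA. Qed.

End LeftMultiplication.

(** [r] picks one element of each coset of [T] and [s] is the remaining [T]-component. The choice is
    made from the coset as a set, so it is invariant; [s (r g) = 1] makes the exchange of components
    in [amalgam_inj] an involution. *)
Lemma equivariant_section (T G : groupType) (i : {multiplicative T -> G}) :
  injective i -> exists (s : G -> T) (r : G -> G),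
    [/\ forall g, g = (i (s g) * r g)%g,
        forall t g, s (i t * g)%g = (t * s g)%g,
        forall t g, r (i t * g)%g = r g &
        forall g, s (r g) = 1%g /\ r (r g) = r g].
Proof.
move=> ii; pose orb (g : G) : set G := [set h | exists t, h = (i t * g)%g].
have orbE t g : orb (i t * g)%g = orb g.
  apply/seteqP; split=> h [t' ->].
    by exists (t' * t)%g; rewrite gmulfM mulgA.
  by exists (t' * t^-1)%g; rewrite gmulfM multV -mulgA mulKg.
pose r g := xget 1%g (orb g).
have rP g : orb g (r g).
  by apply: xgetPex; exists g, 1%g; rewrite mult1 mul1g.
have rE t g : r (i t * g)%g = r g by rewrite /r orbE.
have rr g : r (r g) = r g by have [t e] := rP g; rewrite {1}e rE.
have /choice[s hs] : forall g, exists t, g = (i t * r g)%g.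
  move=> g; have [t e] := rP g.
  by exists t^-1%g; rewrite e multV mulKg.
have s_uniq t g : (i t * r g)%g = g -> s g = t.
  by move=> e; apply: ii; apply: (mulIg (r g)); rewrite -hs e.
exists s, r; split=> // [t g|g].
  by apply: s_uniq; rewrite rE gmulfM -mulgA -hs.
by split=> //; apply: s_uniq; rewrite mult1 mul1g rr.
Qed.

Section Amalgam.
Context (T A B G : groupType).
Context (iA : {multiplicative T -> A}) (iB : {multiplicative T -> B}).
Context (jA : {multiplicative A -> G}) (jB : {multiplicative B -> G}).
Hypothesis amalgam : amalgamated_free_product iA iB jA jB.

(* Both factors act on [A * B], by left multiplication on one coordinate; the
   second action is conjugated by the involution exchanging the [T]-components,
   so that the two actions agree on [T]. *)
Lemma amalgam_inj : injective jA.
Proof.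
have [injA injB ij univ] := amalgam.
have [s [r [sr sM rM rr]]] := equivariant_section injA.
have [s' [r' [sr' sM' rM' rr']]] := equivariant_section injB.
pose phi (x : A * B) := (iA (s' x.2) * r x.1, iB (s x.1) * r' x.2)%g.
have phiK : involutive phi.
  move=> [a b]; rewrite /phi /= !sM !sM' !rM !rM'.
  rewrite (rr a).1 (rr a).2 (rr' b).1 (rr' b).2 !mulg1 -sr -sr'.
  by [].
pose fA (a : A) : bijection (A * B) := left_mult B a.
pose lB (b : B) (x : A * B) := phi ((phi x).1, (b * (phi x).2)%g).
have lBM b b' x : lB (b * b')%g x = lB b (lB b' x).
  by rewrite /lB phiK -[in LHS]mulgA.
have lB1 x : lB 1%g x = x by rewrite /lB mul1g -surjective_pairing phiK.
have lBK b : cancel (lB b) (lB b^-1%g) by move=> x; rewrite -lBM mulVg lB1.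
have lBV b : cancel (lB b^-1%g) (lB b) by move=> x; rewrite -lBM mulgV lB1.
pose fB b := Bijection (lBK b) (lBV b).
have fAM : {morph fA : x y / (x * y)%g} by exact: left_multM.
have fBM : {morph fB : x y / (x * y)%g}.
  by move=> b b'; apply: bijection_ext => x; exact: lBM.
have [|k [kA _ _]] := univ _ (multiplicative_of fAM) (multiplicative_of fBM).
  move=> t; apply: bijection_ext => -[a b] /=.
  rewrite /lB /phi /= !sM !sM' !rM !rM' (rr a).1 (rr' b).1 (rr a).2 (rr' b).2.
  by rewrite !mulg1 gmulfM -mulgA -sr -sr'.
move=> a a' e; have := kA a; have := kA a'; rewrite /= e => -> h.
have := congr1 (fun f : bijection (A * B) => f (1%g, 1%g)) h.
by rewrite /= !mulg1 => -[].
Qed.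

Lemma amalgam_uniq (K : groupType) (f g : {multiplicative G -> K}) :
  f \o jA =1 g \o jA -> f \o jB =1 g \o jB -> f =1 g.
Proof.
move=> fgA fgB; have [_ _ ij univ] := amalgam.
have fAM : {morph f \o jA : x y / (x * y)%g} by move=> x y; rewrite /= !gmulfM.
have fBM : {morph f \o jB : x y / (x * y)%g} by move=> x y; rewrite /= !gmulfM.
have [|k [_ _ ku]] := univ _ (multiplicative_of fAM) (multiplicative_of fBM).
  by move=> t /=; congr (f _); exact: ij.
move=> x; rewrite (ku f) // (ku g) // => y; [exact/esym/fgA | exact/esym/fgB].
Qed.

Definition word_eval (w : seq (A + B)) : G :=
  foldr (fun l g => (match l with inl a => jA a | inr b => jB b end * g)%g) 1%g w.

Lemma word_eval_cat w w' : word_eval (w ++ w') = (word_eval w * word_eval w')%g.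
Proof. by elim: w => [|l w IH] /=; rewrite ?mul1g // IH mulgA. Qed.

(* Let [sigma] exchange the two copies of the subgroup generated by [A] and [B]
   inside [G * bool] and fix the rest: left multiplication by [g] and its
   conjugate by [sigma] agree on the generators, hence for every [g]. *)
Lemma word_eval_surj g : exists w, word_eval w = g.
Proof.
pose gen g := `[< exists w, word_eval w = g >].
have gen1 : gen 1%g by apply/asboolP; exists [::].
have genM h x : gen h -> gen h^-1%g -> gen (h * x)%g = gen x.
  move=> /asboolP[w hw] /asboolP[w' hw']; apply/asboolP/asboolP => -[v hv].
    by exists (w' ++ v); rewrite word_eval_cat hw' hv mulKg.
  by exists (w ++ v); rewrite word_eval_cat hw hv.
have genA a : gen (jA a) by apply/asboolP; exists [:: inl a]; rewrite /= mulg1.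
have genB b : gen (jB b) by apply/asboolP; exists [:: inr b]; rewrite /= mulg1.
pose sigma (x : G * bool) := (x.1, x.2 (+) gen x.1).
have sigmaK : involutive sigma.
  by move=> [x b]; rewrite /sigma /= -addbA addbb addbF.
pose sg : bijection (G * bool) := Bijection sigmaK sigmaK.
pose L : {multiplicative G -> bijection (G * bool)} :=
  multiplicative_of (@left_multM G bool).
pose c (g : G) : bijection (G * bool) := (sg * L g * sg)%g.
have sgg : (sg * sg = 1)%g by apply: bijection_ext => x; exact: sigmaK.
have cM : {morph c : x y / (x * y)%g}.
  by move=> x y; rewrite /c gmulfM !mulgA -(mulgA _ sg sg) sgg mulg1.
have cgen h : gen h -> gen h^-1%g -> L h = c h.
  move=> gh gh'; apply: bijection_ext => -[x b].
  by rewrite /c !bfunM /= /sigma /= genM // -addbA addbb addbF.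
have /(_ g) : L =1 multiplicative_of cM.
  by apply: amalgam_uniq => x /=; apply: cgen; rewrite -?multV.
(* [L g] sends [(1, false)] to [(g, false)] and [c g] sends it to [(g, true (+) gen g)], so [gen g]
   holds. *)
move=> /(congr1 (fun f : bijection (G * bool) => f (1%g, false))).
rewrite /= /sigma /= gen1 mulg1 /=.
by case E : (gen g) => //; move/asboolP: E.
Qed.

Lemma countable_nat_inj (X : Type) :
  countable [set: X] -> exists f : X -> nat, injective f.
Proof.
by move=> /countable_injP[f fi]; exists f => x y; apply: fi; rewrite inE.
Qed.

Lemma amalgam_countable : countable [set: A] -> countable [set: B] ->
  countable [set: G].
Proof.
move=> /countable_nat_inj[f fi] /countable_nat_inj[g gi].
have [w hw] := choice word_eval_surj.
pose code (l : A + B) : nat + nat :=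
  match l with inl a => inl (f a) | inr b => inr (g b) end.
have ci : injective code by move=> [a|b] [a'|b'] //= [] => [/fi|/gi] ->.
apply/countable_injP; exists (fun x => pickle (map code (w x))) => x y _ _.
move=> /(pcan_inj pickleK)/(inj_map ci) e.
by rewrite -(hw x) -(hw y) e.
Qed.

End Amalgam.

(** * Extension of cocycles *)

Section CrossedGroup.
Context (R : realType) (H : hilbertType R) (M : set (H -> H)).
Context (hM : von_neumann_algebra M).
Local Notation A := (vna hM).
Context (G : groupType) (alpha : G -> A -> A).

Lemma vn_unitary1 : vn_unitary (1 : A).
Proof. by rewrite /vn_unitary star1 mulr1. Qed.

Lemma vn_unitaryM (u w : A) : vn_unitary u -> vn_unitary w -> vn_unitary (u * w).
Proof.
move=> [u1 u2] [w1 w2]; rewrite /vn_unitary starM; split.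
  by rewrite -mulrA (mulrA (star u)) u1 mul1r.
by rewrite -mulrA (mulrA w) w2 mul1r.
Qed.

Lemma vn_unitary_star (u : A) : vn_unitary u -> vn_unitary (star u).
Proof. by move=> [u1 u2]; rewrite /vn_unitary starK. Qed.

(* The semidirect product of the unitary group of [M] by [G]: its elements over
   [g] are the possible values at [g] of a cocycle, and cocycles are the
   homomorphic sections. *)
Record crossed (act : vn_action alpha) :=
  Crossed { cross_unit : A; cross_unitP : vn_unitary cross_unit; cross_elt : G }.

Context (act : vn_action alpha).
Local Notation K := (crossed act).

HB.instance Definition _ := gen_eqMixin K.
HB.instance Definition _ := gen_choiceMixin K.

Lemma crossed_ext (x y : K) :
  cross_unit x = cross_unit y -> cross_elt x = cross_elt y -> x = y.
Proof.
case: x y => [u uP g] [w wP h] /= e <-; case: w / e wP => wP.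
by rewrite (Prop_irrelevance uP wP).
Qed.

Lemma vact_unitary g (u : A) : vn_unitary u -> vn_unitary (alpha g u).
Proof.
move=> [u1 u2]; rewrite /vn_unitary -(vact_star act) -!(vactM act) u1 u2.
by rewrite (vact1 act).
Qed.

Let one : K := Crossed act vn_unitary1 1%g.
Let mul (x y : K) : K :=
  Crossed act (vn_unitaryM (cross_unitP x) (vact_unitary (cross_elt x) (cross_unitP y)))
    (cross_elt x * cross_elt y)%g.
Let inv (x : K) : K :=
  Crossed act (vact_unitary (cross_elt x)^-1%g (vn_unitary_star (cross_unitP x)))
    (cross_elt x)^-1%g.

Let mulA : associative mul.
Proof.
move=> x y z; apply: crossed_ext => /=; last exact: mulgA.
by rewrite (vactM act) (vact_comp act) mulrA.
Qed.
Let mul1 : left_id one mul.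
Proof.
by move=> x; apply: crossed_ext; rewrite /= ?(vact_one act) ?mul1r ?mul1g.
Qed.
Let mulx1 : right_id one mul.
Proof. by move=> x; apply: crossed_ext; rewrite /= ?(vact1 act) ?mulr1 ?mulg1. Qed.
Let mulV : left_inverse one inv mul.
Proof.
move=> x; apply: crossed_ext; rewrite /= ?mulVg // -(vactM act).
by rewrite (cross_unitP x).1 (vact1 act).
Qed.
Let mulxV : right_inverse one inv mul.
Proof.
move=> x; apply: crossed_ext; rewrite /= ?mulgV // (vactK act).
exact: (cross_unitP x).2.
Qed.

HB.instance Definition _ := isGroup.Build K mulA mul1 mulx1 mulV mulxV.

Definition cross_proj : K -> G := @cross_elt act.

(** Both cocycles are homomorphisms to the semidirect product and agree on [T], so the universal
    property merges them into [k]. By uniqueness its projection to [G] is the identity, which makes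
    its unitary part a cocycle. *)
Lemma amalgam_cocycle (T B1 B2 : groupType)
    (i1 : {multiplicative T -> B1}) (i2 : {multiplicative T -> B2})
    (j1 : {multiplicative B1 -> G}) (j2 : {multiplicative B2 -> G})
    (v1 : B1 -> A) (v2 : B2 -> A) :
  amalgamated_free_product i1 i2 j1 j2 ->
  vn_cocycle (fun b => alpha (j1 b)) v1 -> vn_cocycle (fun b => alpha (j2 b)) v2 ->
  (forall t, v1 (i1 t) = v2 (i2 t)) ->
  exists2 v, vn_cocycle alpha v & forall b, v (j1 b) = v1 b.
Proof.
move=> am [v1U v1M] [v2U v2M] v12; have [_ _ ij univ] := am.
pose f1 b : K := Crossed act (v1U b) (j1 b).
pose f2 b : K := Crossed act (v2U b) (j2 b).
have f1M : {morph f1 : x y / (x * y)%g}.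
  by move=> x y; apply: crossed_ext => /=; rewrite ?v1M ?gmulfM.
have f2M : {morph f2 : x y / (x * y)%g}.
  by move=> x y; apply: crossed_ext => /=; rewrite ?v2M ?gmulfM.
have [|k [k1 k2 _]] := univ _ (multiplicative_of f1M) (multiplicative_of f2M).
  by move=> t; apply: crossed_ext; [exact: v12 | exact: ij].
have pkM : {morph cross_proj \o k : x y / (x * y)%g} by move=> x y; rewrite /= gmulfM.
have idM : {morph (id : G -> G) : x y / (x * y)%g} by [].
have pk : multiplicative_of pkM =1 multiplicative_of idM.
  by apply: (amalgam_uniq am) => b; rewrite /= ?(k1 b) ?(k2 b) //;
    [have := k1 b | have := k2 b] => /= ->.
have pkE g : cross_elt (k g) = g by exact: pk g.
exists (fun g => cross_unit (k g)) => [|b].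
  split=> [g|g h]; first exact: cross_unitP.
  by rewrite gmulfM /= pkE.
by have := k1 b => /= ->.
Qed.

End CrossedGroup.

(** * From operators on [H] to the bundled algebra *)

Section Transfer.
Context (R : realType) (H : hilbertType R) (M : set (H -> H)).
Context (hM : von_neumann_algebra M).
Local Notation C := (cplx R).
Local Notation A := (vna hM).

Lemma factor_central_scalars : Defs.factor M -> central_scalars hM.
Proof.
move=> [_ fM] a ha; have : (M `&` commutant M) a.
  split; first exact: vopP.
  split=> [|y My]; first exact: (vn_bounded hM (vopP a)).
  by have /(congr1 (@vop _ _ _ hM)) := ha (Vna hM My).
by rewrite fM => -[c ac]; exists c; exact: vop_inj.
Qed.

Lemma predualD (f : (H -> H) -> C) x y : predual M f -> M x -> M y ->
  f (x + y) = f x + f y.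
Proof.
move=> [xi [eta [_ _ hf]]] Mx My; have cxy := hf _ (vn_add hM Mx My).
suff c : series (fun n => inner ((x + y) (xi n)) (eta n)) @ \oo --> f x + f y.
  exact: cvg_unique cxy c.
have -> : series (fun n => inner ((x + y) (xi n)) (eta n)) =
    series (fun n => inner (x (xi n)) (eta n)) +
    series (fun n => inner (y (xi n)) (eta n)).
  apply/funext => n; rewrite /series /= -[RHS]big_split /=; apply: eq_bigr => i _.
  by rewrite -linearDl.
exact: cvgD (hf _ Mx) (hf _ My).
Qed.

Lemma trace_transfer (tau : (H -> H) -> C) :
  faithful_normal_tracial_state M tau ->
  faithful_trace (fun a : A => complex.Re (tau a : R[i])).
Proof.
move=> [tp _ t0 tf tc]; split=> [a b|a b|a|a h].
- by rewrite -raddfD /= -predualD //; exact: vopP.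
- by congr complex.Re; apply: tc; exact: vopP.
- by have := t0 _ (vopP a); rewrite lecE => /andP[].
- apply: vop_inj; apply: tf; first exact: vopP.
  have -> : tau (adj a \o a) = cR (complex.Re (tau (adj a \o a) : R[i])).
    by apply: cR_ReE; exact: t0 (vopP a).
  by rewrite -[adj a \o a]/(vop (star a * a)) h.
Qed.

(** [theta idfun] is a unit for the image of [theta], which is all of [M]. *)
Lemma star_automorphism_id theta : star_automorphism M theta ->
  theta idfun = idfun.
Proof.
move=> [[homo _ surj] _ tM _].
have [x Mx ex] := surj _ (vn_id hM).
by have := tM _ _ (vn_id hM) Mx; rewrite -[idfun \o x]/x ex => e; rewrite [RHS]e.
Qed.

Context (G : groupType) (alpha : G -> (H -> H) -> H -> H).
Hypothesis act : Defs.is_action M alpha.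

Lemma action_mem g x : M x -> M (alpha g x).
Proof. by have [[h _ _] _ _ _] := act.1 g; exact: h. Qed.

Definition vn_of_action (g : G) (a : A) : A := Vna hM (action_mem g (vopP a)).

Lemma action_lin g c x y : M x -> M y ->
  alpha g (c *: x + y) = c *: alpha g x + alpha g y.
Proof. by have [_ h _ _] := act.1 g; exact: h. Qed.

Lemma vn_of_actionP : vn_action vn_of_action.
Proof.
split=> [t a b|t a b|t a|t c|s t a|a]; apply: vop_inj; rewrite /=.
- by have := action_lin t 1 (vopP a) (vopP b); rewrite !scale1r.
- by have [_ _ h _] := act.1 t; apply: h; exact: vopP.
- by have [_ _ _ h] := act.1 t; apply: h; exact: vopP.
- have M0 := vn_zero hM.
  have a0 : alpha t 0 = 0.
    have := action_lin t 1 M0 M0; rewrite !scale1r addr0 => e.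
    by apply: (addrI (alpha t 0)); rewrite -e addr0.
  have := action_lin t c (vn_id hM) M0; rewrite !addr0 a0 addr0.
  by rewrite (star_automorphism_id (act.1 t)).
- exact: act.2 _ _ _ (vopP a).
(* [alpha 1] is injective and idempotent, hence the identity on [M]. *)
- have [[h inj _] _ _ _] := act.1 1%g.
  apply: inj; rewrite ?inE; [exact: action_mem (vopP a) | exact: vopP |].
  by rewrite -act.2 ?mulg1 //; exact: vopP.
Qed.

Lemma vn_unitary_in (u : A) : vn_unitary u <-> unitary_in M u.
Proof.
split=> [[/(congr1 (@vop _ _ _ hM)) u1 /(congr1 (@vop _ _ _ hM)) u2]|[_ u1 u2]].
  by split=> //; exact: vopP.
by split; apply: vop_inj.
Qed.

Lemma vn_of_action_outer : outer_action M alpha -> vn_outer vn_of_action.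
Proof.
move=> [_ out] t t1 u uU h; apply: (out t t1); exists u; first exact/vn_unitary_in.
by move=> x Mx; have /(congr1 (@vop _ _ _ hM)) := h (Vna hM Mx).
Qed.

Lemma vn_cocycleP (v : G -> A) :
  vn_cocycle vn_of_action v <-> cocycle M alpha (fun g => vop (v g)).
Proof.
split=> -[vU vM]; split=> [g|g h]; try exact/vn_unitary_in.
  by have /(congr1 (@vop _ _ _ hM)) := vM g h.
exact/vop_inj/vM.
Qed.

Lemma scalars_fixed (v : G -> H -> H) : cocycle M alpha v ->
  @scalars R H `<=` fixed_points M (perturbation alpha v).
Proof.
move=> [vU _] _ [c ->]; have Mc := vn_scale hM c (vn_id hM).
split=> // g; have [Mv _ vv] := vU g.
have ac : alpha g (c *: idfun) = c *: idfun.
  by have /(congr1 (@vop _ _ _ hM)) := vact_sc vn_of_actionP g c.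
rewrite /perturbation /= /Ad ac; apply/funext => w /=.
rewrite -[(c *: idfun) _]/(c *: _) (linZ (vn_linear hM Mv)).
by have /(congr1 (@^~ w)) /= -> := vv.
Qed.

End Transfer.

(** * Gluing over the amalgam *)

Lemma vn_action_comp (R : realType) (H : hilbertType R) (M : set (H -> H))
    (hM : von_neumann_algebra M) (G G' : groupType) (j : {multiplicative G' -> G})
    (alpha : G -> vna hM -> vna hM) :
  vn_action alpha -> vn_action (alpha \o j).
Proof.
move=> act; split=> *; rewrite /= ?gmulfM ?mult1.
- exact: (vactD act).
- exact: (vactM act).
- exact: (vact_star act).
- exact: (vact_sc act).
- exact: (vact_comp act).
- exact: (vact_one act).
Qed.

Lemma vn_coboundary (R : realType) (H : hilbertType R) (M : set (H -> H))
    (hM : von_neumann_algebra M) (G : groupType) (alpha : G -> vna hM -> vna hM)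
    (u : vna hM) :
  vn_action alpha -> vn_unitary u -> vn_cocycle alpha (fun g => u * alpha g (star u)).
Proof.
move=> act uU; split=> [g|g h].
  by apply: vn_unitaryM => //; apply: (vact_unitary act); exact: vn_unitary_star.
rewrite (vact_comp act) (vactM act) -!mulrA; congr (_ * _).
by rewrite mulrA -(vactM act) uU.1 (vact1 act) mul1r.
Qed.

Theorem proposition3p4 (R : realType) (T : finGroupType)
    (Gamma Lambda G : groupType)
    (iGamma : {multiplicative T -> Gamma})
    (iLambda : {multiplicative T -> Lambda})
    (jGamma : {multiplicative Gamma -> G})
    (jLambda : {multiplicative Lambda -> G}) :
  amalgamated_free_product iGamma iLambda jGamma jLambda ->
  Erg R Gamma ->
  countable [set: Lambda] ->
  Erg R G.
Proof.
move=> am [cG erg] cL; split; first exact: amalgam_countable am cG cL.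
move=> H M alpha II sp out; have [fM _ [tau tauP]] := II.
have hM := fM.1; have act := out.1.
have jinj := amalgam_inj am; have [iinj _ ij _] := am.
pose alphaG g := alpha (jGamma g).
have outG : outer_action M alphaG.
  split; first split=> [g|g h x Mx]; first exact: act.1.
    by rewrite /alphaG gmulfM; exact: act.2.
  (* Outerness survives the restriction because [jGamma] is injective. *)
  move=> g g1; apply: out.2 => jg; apply: g1; apply: jinj.
  by rewrite jg mult1.
have [v vc ve] := erg H M alphaG II sp outG.
pose beta := vn_of_action (hM := hM) act.
have betaP : vn_action beta := vn_of_actionP hM act.
have cent : central_scalars hM := factor_central_scalars fM.
pose v1 g : vna hM := Vna hM (let: And3 h _ _ := vc.1 g in h).
have v1c : vn_cocycle (beta \o jGamma) v1.
  by split=> [g|g h]; [apply/vn_unitary_in; exact: vc.1 | apply: vop_inj; exact: vc.2].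
have jM : {morph jGamma \o iGamma : s t / (s * t)%g}.
  by move=> s t; rewrite /= !gmulfM.
pose j : {multiplicative T -> G} := multiplicative_of jM.
have outT : vn_outer (beta \o j).
  move=> t t1; apply: (vn_of_action_outer (act := act) out) => jt; apply: t1.
  by apply: iinj; apply: jinj; rewrite !mult1.
have vTc : vn_cocycle (beta \o j) (v1 \o iGamma).
  by split=> [t|s t]; [exact: v1c.1 | rewrite /= gmulfM; exact: v1c.2].
have [u [uU uv]] := cocycle_coboundary (vn_action_comp j betaP) vTc cent outT
  (trace_transfer hM tauP).
have v2c := vn_coboundary (vn_action_comp jLambda betaP) uU.
have [|V Vc Vv] := amalgam_cocycle betaP am v1c v2c.
  (* [uv t] reads [v t * alpha t u = u]; multiplying by [alpha t (star u)] on the right gives the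
     coboundary form of [v t]. *)
  move=> t; have e : jLambda (iLambda t) = jGamma (iGamma t) by have := ij t.
  rewrite /= e (vact_star betaP).
  by rewrite -{1}(uv t) -mulrA (vact_unitary betaP _ uU).2 mulr1.
exists (fun g => vop (V g)); first exact/(vn_cocycleP act).
apply/seteqP; split; last by apply: (scalars_fixed hM act); exact/(vn_cocycleP act).
move=> x [Mx fx]; rewrite -ve; split=> // g.
by have := fx (jGamma g); rewrite /perturbation /= Vv.
Qed.
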